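(* Let $\Delta_n$ be the distance between two randomly selected keys in a trie of $n$ random keys following the unbiased Bernoulli model. Then $\Delta_n - \lfloor 2\lg n\rfloor$ has an oscillating moment generating function, and, consequently, does not converge in distribution to any random variable (as $n\to\infty$).
   Context: Notation: $\lg=\log_2$; $\lfloor x\rfloor$ is the floor of $x$. The moment generating function of a random variable $X$ is $t\mapsto\mathbf{E}[e^{tX}]$. Trie: given $n$ keys, each an infinite sequence of bits, the binary trie is built recursively. If $n=0$ the tree is empty. If $n=1$ it is a single leaf holding the key. If $n\ge 2$ it has an internal root node; the keys whose first bit is $0$ go to the left subtree and those whose first bit is $1$ go to the right subtree, and each subtree is built recursively from its keys, using the $(\ell+1)$st bit for branching at level $\ell$ (the root is at level $0$). Thus internal nodes may have one or two (nonempty) children, and each key ends up alone in a leaf. Unbiased Bernoulli model: the $n$ keys are independent, and the bits of each key are independent and take the values $0$ and $1$ with probability $1/2$ each. Distance: $\Delta_n$ ($n\ge 2$) is the number of tree edges on the path between the leaves of two distinct keys chosen at random, all $\binom n2$ pairs of keys being equally likely, in the random trie on $n$ keys; both the trie and the pair are random. *)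

(* Defs.v *)
From HB Require Import structures.
From mathcomp Require Import all_boot all_order all_algebra.
From mathcomp Require Import all_classical all_reals all_analysis.
From mathcomp Require Import measurable_realfun.
Set Implicit Arguments.
Unset Strict Implicit.
Unset Printing Implicit Defensive.
Import Order.TTheory GRing.Theory Num.Theory.
Import numFieldNormedType.Exports.
Local Open Scope classical_set_scope.
Local Open Scope ring_scope.

Inductive tree (K : Type) : Type :=
| Empty
| Leaf of K
| Node of tree K & tree K.
Arguments Empty {K}.
Arguments Leaf {K} _.
Arguments Node {K} _ _.

(* [is_trie bit l ks t]: [t] is the trie on the keys [ks], branching on bit
   [l] at its root; [bit k l] is the bit of key [k] used at level [l] (so bits
   are numbered from 0), and [false] / [true] stand for 0 / 1.  The recursion
   is a relation because two equal infinite keys have no finite trie. *)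
Inductive is_trie (K : Type) (bit : K -> nat -> bool) :
    nat -> seq K -> tree K -> Prop :=
| TrieEmpty l : is_trie bit l [::] Empty
| TrieLeaf l k : is_trie bit l [:: k] (Leaf k)
| TrieNode l ks t0 t1 :
    (2 <= size ks)%N ->
    is_trie bit l.+1 [seq k <- ks | ~~ bit k l] t0 ->
    is_trie bit l.+1 [seq k <- ks | bit k l] t1 ->
    is_trie bit l ks (Node t0 t1).

(* A node is addressed by the word read on the branch from the root to it;
   addresses that are not in the tree are sent to [Empty]. *)
Fixpoint subtree (K : Type) (t : tree K) (u : seq bool) : tree K :=
  match u, t with
  | [::], _ => t
  | b :: u', Node t0 t1 => subtree (if b then t1 else t0) u'
  | _ :: _, _ => Empty
  end.

Definition is_node (K : Type) (t : tree K) (u : seq bool) : bool :=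
  if subtree t u is Empty then false else true.

Definition tree_edge (K : Type) (t : tree K) : rel (seq bool) := fun u v =>
  [&& is_node t u, is_node t v &
      [exists b : bool, (v == rcons u b) || (u == rcons v b)]].

(* The simple path between the leaves of [i] and [j] has [m] edges. *)
Definition leaf_distance (K : Type) (t : tree K) (i j : K) (m : nat) : Prop :=
  exists u v p,
    [/\ subtree t u = Leaf i, subtree t v = Leaf j,
        path (tree_edge t) u p && uniq (u :: p), last u p = v & size p = m].

Definition trie_distance (n : nat) (bit : 'I_n -> nat -> bool) (i j : 'I_n)
    (m : nat) : Prop :=
  exists2 t, is_trie bit 0 (enum 'I_n) t & leaf_distance t i j m.

(* Events determined by a map into a finite (discrete) set. *)
Definition events_of (T U : Type) (X : T -> U) : set (set T) :=
  range (fun B : set U => X @^-1` B).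

Definition mutually_independent (d : measure_display) (T : measurableType d)
    (R : realType) (P : probability T R) (I : eqType) (F : I -> set (set T)) :=
  forall (s : seq I) (A : I -> set T), uniq s ->
    (forall i, i \in s -> F i (A i)) ->
    P (\bigcap_(i in [set i | i \in s]) A i) = (\prod_(i <- s) P (A i))%E.

(* The sources of randomness: index [Some (i, l)] is bit [l] of key [i], and
   [None] is the choice of the pair. *)
Definition trie_events (T : Type) (n : nat) (key : 'I_n -> nat -> T -> bool)
    (pair : T -> 'I_n * 'I_n) (a : option ('I_n * nat)) : set (set T) :=
  if a is Some (i, l) then events_of (key i l) else events_of pair.

(* [key i l w] is bit [l] of the [i]-th key.  The unordered pair of distinct
   keys [{i, j}] is represented by [(i, j)] with [i < j]. *)
Record unbiased_trie_model (d : measure_display) (T : measurableType d)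
    (R : realType) (P : probability T R) (n : nat)
    (key : 'I_n -> nat -> T -> bool) (pair : T -> 'I_n * 'I_n) : Prop := {
  measurable_key : forall i l, measurable_fun [set: T] (key i l) ;
  measurable_pair : forall q, measurable (pair @^-1` [set q]) ;
  fair_bit : forall i l b, P (key i l @^-1` [set b]) = (2^-1)%:E ;
  uniform_pair : forall i j : 'I_n, (i < j)%N ->
    P (pair @^-1` [set (i, j)]) = ('C(n, 2)%:R^-1)%:E ;
  independent_trie : mutually_independent P (trie_events key pair)
}.

(* [D] is a version of the distance between two random keys: the trie exists
   only almost surely, namely when the keys are distinct. *)
Definition random_trie_distance (d : measure_display) (T : measurableType d)
    (R : realType) (P : probability T R) (n : nat) (D : {RV P >-> R}) : Prop :=
  exists (key : 'I_n -> nat -> T -> bool) (pair : T -> 'I_n * 'I_n),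
    unbiased_trie_model P key pair /\
    {ae P, forall w, exists2 m : nat, D w = m%:R &
       trie_distance (fun i l => key i l w) (pair w).1 (pair w).2 m}.

Definition lg (R : realType) (x : R) : R := ln x / ln 2.

Definition centered (d : measure_display) (T : measurableType d)
    (R : realType) (P : probability T R) (n : nat) (D : {RV P >-> R}) :
    {RV P >-> R} :=
  D \- cst ((Num.floor (2 * lg (n%:R : R)))%:~R : R).

(* Bounded (from some rank on) but without a limit. *)
Definition oscillates (R : realType) (u : (\bar R)^nat) : Prop :=
  (-oo < limn_einf u /\ limn_einf u < limn_esup u /\ limn_esup u < +oo)%E.

(* Pointwise reading of the oscillation of a sequence of moment generating
   functions, on a neighbourhood of 0; at 0 itself they are all equal to 1,
   and away from 0 they may be infinite. *)
Definition oscillating_mgf (R : realType) (d : nat -> measure_display)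
    (T : forall n, measurableType (d n)) (P : forall n, probability (T n) R)
    (X : forall n, {RV (P n) >-> R}) : Prop :=
  exists2 r : R, 0 < r & forall t : R, t != 0 -> `|t| < r ->
    oscillates (fun n => mmt_gen_fun (P n) (X n) t).

Definition cvg_in_distribution (R : realType) (d : nat -> measure_display)
    (T : forall n, measurableType (d n)) (P : forall n, probability (T n) R)
    (X : forall n, {RV (P n) >-> R})
    (d' : measure_display) (T' : measurableType d') (Q : probability T' R)
    (Y : {RV Q >-> R}) : Prop :=
  forall x : R, {for x, continuous (cdf Y)} ->
    cdf (X n) x @[n --> \oo] --> cdf Y x.

Arguments oscillating_mgf {R d T} P X.
Arguments cvg_in_distribution {R d T} P X {d' T' Q} Y.

(* Main.v *)
Require Import Defs.
From mathcomp Require Import all_boot all_order all_algebra.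
From mathcomp Require Import all_classical all_reals all_analysis.
From mathcomp Require Import measurable_realfun.
From mathcomp Require Import zify ring lra.
Set Implicit Arguments.
Unset Strict Implicit.
Unset Printing Implicit Defensive.
Import Order.TTheory GRing.Theory Num.Theory.
Import numFieldNormedType.Exports.

(** For keys [i < j] let [L] be the length of their longest common prefix and
    [X], [Y] the depths of their leaves, so that the distance is [X + Y - 2 L].
    Counting bit matrices gives
      P(L = l, X <= x, Y <= y) = 2^-(l+1) (1 - 2^-x - 2^-y)^(n-2)
    for [l < x, y].  Two consequences: [Delta_n - floor (2 lg n)] has
    exponential tails uniformly in [n], and the laws of [Delta_n] and
    [Delta_(n+1)] merge as [n] grows, since [q^m - q^(m+1) <= 1/(m+1)] on
    [0, 1].  But [floor (2 lg n)] jumps by 1 between [2^(h+1) - 1] and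
    [2^(h+1)]; hence a limit [c] of the moment generating functions at [t]
    would satisfy [c = e^t c] with [c > 0], and a limit distribution function
    would be invariant under the translation by 1. *)

(** * Paths between leaves of a trie *)

(** The variables [Delta n] live on unrelated probability spaces, so sizes [n] and [n + 1] are
    compared through their laws and not by adding a key to a trie; hence the explicit formula. Once
    the two chosen keys split at bit [l], their cylinders of lengths [x, y > l] are disjoint and
    each of the other [n - 2] keys must avoid both; [n] enters only through that exponent, so the
    comparison is one of consecutive powers. The comparison is pointwise: it is summed over a box of
    fixed size [k] around the typical values, the tails control the rest, and [n] goes to infinity
    before [k]. Outside the box the mass decays like [2^-k] while the deviation inside grows like
    [4 k]; this is why [t] is restricted by [e^(4 |t|) <= 3 / 2 < 2]. Moment generating functions
    and distribution functions are both integrals of test functions bounded by [e^(s |z|)], so one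
    merging statement serves for both. *)

Section Path.
Let parent_child : rel (seq bool) := fun u v =>
  [exists b : bool, (v == rcons u b) || (u == rcons v b)].

Let parent_childP u v : parent_child u v ->
  exists b, v = rcons u b \/ u = rcons v b.
Proof. by move=> /existsP[b /orP[] /eqP ->]; exists b; [left|right]. Qed.

(* A simple path cannot go back up: the parent was already visited. *)
Lemma path_down u b p : path parent_child (rcons u b) p ->
  uniq (u :: rcons u b :: p) ->
  exists2 s, last (rcons u b) p = rcons u b ++ s & size p = size s.
Proof.
elim: p u b => [|w p IH] u b /=; first by exists [::]; rewrite ?cats0.
move=> /andP[/parent_childP[c [->|wE]] pth].
  move=> /andP[_ uq]; have [s -> ->] := IH _ _ pth uq.
  by exists (c :: s); rewrite // -cat_rcons.
by move/rcons_inj: wE => [<- _]; rewrite !inE eqxx orbT.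
Qed.

(** The path climbs to an ancestor [c] and can only descend afterwards. The first step down avoids
    the child it came from, already visited, so [c] is the longest common prefix of both ends. The
    extra vertex [rcons u b] before the path records that child. *)
Lemma path_up u b p : path parent_child u p -> uniq (rcons u b :: u :: p) ->
  exists c a s, [/\ rcons u b = c ++ a, last u p = c ++ s, a != [::],
    s != [::] -> head true a != head true s & (size p).+1 = size a + size s].
Proof.
elim: p u b => [|w p IH] u b /=.
  by exists u, [:: b], [::]; rewrite cats1 cats0.
move=> /andP[/parent_childP[c [->|uE]] pth].
  move=> /andP[+ uq]; rewrite !inE !negb_or => /and3P[_ bc _].
  have [|s -> ->] := path_down pth; first exact: uq.
  exists u, [:: b], (c :: s); rewrite cats1 -cat_rcons; split=> //.
  by move=> _ /=; apply: contraNneq bc => ->.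
move=> /andP[_]; rewrite uE => uq; have [v [a [s [Ew -> a0 hd sz]]]] := IH _ c pth uq.
exists v, (rcons a b), s; split.
- by rewrite Ew rcons_cat.
- by [].
- by case: (a).
- by move/hd; case: (a) a0.
- by rewrite sz size_rcons.
Qed.

Lemma tree_path_size (K : Type) (t : tree K) u p v :
  path (tree_edge t) u p -> uniq (u :: p) -> last u p = v ->
  exists c a s, [/\ u = c ++ a, v = c ++ s,
    a != [::] -> s != [::] -> head true a != head true s &
    size p = size a + size s].
Proof.
move=> pth uq vE.
have {}pth : path parent_child u p.
  by apply: sub_path pth => x y /and3P[].
case: p uq pth vE => [|w p] /= uq; first by move=> _ <-; exists u, [::], [::]; rewrite cats0.
move=> /andP[/parent_childP[b [wE|uE]] pth] vE.
  rewrite wE in uq pth vE; have [s] := path_down pth uq.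
  rewrite vE => {}vE sz; exists u, [::], (b :: s); rewrite cats0 -cat_rcons.
  by split; rewrite ?sz.
rewrite uE in uq; have [c [a [s [E1 E2 E3 E4 E5]]]] := path_up pth uq.
by exists c, a, s; rewrite uE -vE E1 E2.
Qed.
End Path.

(** A leaf sits at the shortest prefix that isolates its key: the key is alone with the address [u],
    and the parent node was built from at least two keys, all sharing one bit less. *)
Lemma trie_leafE (K : eqType) (bit : K -> nat -> bool) l ks t u i :
  is_trie bit l ks t -> subtree t u = Leaf i ->
  [seq k <- ks | mkseq (fun m => bit k (l + m)) (size u) == u] = [:: i] /\
  (u != [::] -> 1 < size [seq k <- ks |
     mkseq (fun m => bit k (l + m)) (size u).-1 == take (size u).-1 u]).
Proof.
move=> Ht; elim: Ht u => {l ks t} [l|l k|l ks t0 t1 sz _ IH0 _ IH1] u.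
- by case: u.
- by case: u => //= -[->]; rewrite /mkseq /=.
case: u => [|b u] //= su.
have E (u0 : seq bool) k : mkseq (fun m => bit k (l + m)) (size u0).+1 =
    bit k l :: mkseq (fun m => bit k (l.+1 + m)) (size u0).
  rewrite /mkseq /= addn0; congr cons; rewrite -[1]addn0 iotaDl -map_comp.
  by apply: eq_map => m /=; rewrite add1n addSnnS.
have [F1 F2] : [seq k <- [seq k <- ks | bit k l == b] |
     mkseq (fun m => bit k (l.+1 + m)) (size u) == u] = [:: i] /\
  (u != [::] -> 1 < size [seq k <- [seq k <- ks | bit k l == b] |
     mkseq (fun m => bit k (l.+1 + m)) (size u).-1 == take (size u).-1 u]).
  case: b su => /= su.
    have -> : [seq k <- ks | bit k l == true] = [seq k <- ks | bit k l].
      by apply: eq_filter => k; rewrite eqb_id.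
    exact: IH1.
  have -> : [seq k <- ks | bit k l == false] = [seq k <- ks | ~~ bit k l].
    by apply: eq_filter => k; rewrite eqbF_neg.
  exact: IH0.
split.
  rewrite -F1 -filter_predI; apply: eq_filter => k /=.
  by rewrite E eqseq_cons andbC.
move=> _; case: u {su F1} F2 => [|c u] F2.
  by rewrite take0 /mkseq /= filter_predT.
have := F2 isT; rewrite -filter_predI [(size (c :: u)).-1]/=.
congr (1 < size _); apply: eq_filter => k.
by rewrite E [take _ (b :: _)]/= eqseq_cons /= andbC.
Qed.

(** * Depths of two leaves in terms of the bits *)

Section Joint.
Variables (n : nat) (bit : 'I_n -> nat -> bool).

(* The keys [i] and [j] first differ at bit [l], and their leaves have depths
   at most [x] and [y]: no other key shares [x] bits with [i], or [y] with [j]. *)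
Definition depths_le (i j : 'I_n) (l x y : nat) : bool :=
  [&& mkseq (bit i) l == mkseq (bit j) l, bit i l != bit j l,
   [forall k, (k != i) ==> (mkseq (bit k) x != mkseq (bit i) x)] &
   [forall k, (k != j) ==> (mkseq (bit k) y != mkseq (bit j) y)]].

(* The leaves have depths exactly [x] and [y] ([0.-1 = 0] is harmless, since
   [depths_le i j l x y] forces [l < x] and [l < y]). *)
Definition depths_eq (i j : 'I_n) (l x y : nat) : bool :=
  [&& depths_le i j l x y, ~~ depths_le i j l x.-1 y & ~~ depths_le i j l x y.-1].

Lemma eq_mkseqP (T : eqType) (f g : nat -> T) m :
  reflect (forall l, l < m -> f l = g l) (mkseq f m == mkseq g m).
Proof.
apply: (iffP eqP) => [E l lm|E].
  by rewrite -(nth_mkseq (f 0) f lm) E nth_mkseq.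
by apply: (@eq_from_nth _ (f 0)); rewrite !size_mkseq // => l lm; rewrite !nth_mkseq // E.
Qed.

Lemma eq_mkseqW (T : eqType) (f g : nat -> T) m m' : m <= m' ->
  mkseq f m' == mkseq g m' -> mkseq f m == mkseq g m.
Proof.
move=> mm /eq_mkseqP E; apply/eq_mkseqP => l lm; apply: E.
exact: leq_trans mm.
Qed.

Lemma depths_le_mono i j l x y x' y' : x <= x' -> y <= y' ->
  depths_le i j l x y -> depths_le i j l x' y'.
Proof.
move=> xx yy /and4P[Hl Hd /forallP Hx /forallP Hy].
apply/and4P; split=> //; apply/forallP => k; apply/implyP => ki.
  have := Hx k; rewrite ki /=; apply: contraNN; exact: eq_mkseqW.
have := Hy k; rewrite ki /=; apply: contraNN; exact: eq_mkseqW.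
Qed.

Lemma depths_le_lcp i j l l' x y x' y' :
  depths_le i j l x y -> depths_le i j l' x' y' -> l = l'.
Proof.
move=> /and4P[/eq_mkseqP E D _ _] /and4P[/eq_mkseqP E' D' _ _].
case: (ltngtP l l') => // [ll|ll].
  by rewrite (E' _ ll) eqxx in D.
by rewrite (E _ ll) eqxx in D'.
Qed.

(** The two depth bounds are separate conditions, hence closed under intersection;
    inclusion-exclusion and the uniqueness of the exact depths both rest on this. *)
Lemma depths_le_meet i j l x y x' y' : depths_le i j l x y ->
  depths_le i j l x' y' -> depths_le i j l (minn x x') (minn y y').
Proof.
move=> /and4P[Hl Hd Hx Hy] /and4P[_ _ Hx' Hy'].
by rewrite /minn; case: ifP => _; case: ifP => _; apply/and4P.
Qed.

Lemma depths_le_gt i j l x y : i != j -> depths_le i j l x y -> (l < x) && (l < y).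
Proof.
move=> ij /and4P[E D /forallP Hx /forallP Hy]; apply/andP; split.
  rewrite ltnNge; apply/negP => xl; have := Hx j; rewrite eq_sym ij /=.
  by rewrite eq_sym (eq_mkseqW xl E).
rewrite ltnNge; apply/negP => xl; have := Hy i; rewrite ij /=.
by rewrite (eq_mkseqW xl E).
Qed.

Lemma depths_eq_inj i j l x y l' x' y' : depths_eq i j l x y ->
  depths_eq i j l' x' y' -> [/\ l = l', x = x' & y = y'].
Proof.
move=> /and3P[A A1 A2] /and3P[B B1 B2].
have E := depths_le_lcp A B; rewrite -E in B B1 B2 *.
have C := depths_le_meet A B.
split=> //.
  case: (ltngtP x x') => // xx; exfalso.
  - by move/negP: B1; apply; apply: depths_le_mono C; lia.
  - by move/negP: A1; apply; apply: depths_le_mono C; lia.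
case: (ltngtP y y') => // yy; exfalso.
- by move/negP: B2; apply; apply: depths_le_mono C; lia.
- by move/negP: A2; apply; apply: depths_le_mono C; lia.
Qed.

(** The common part of the two leaf addresses is the longest common prefix of the keys, and the two
    halves of the path have [x - l] and [y - l] edges. The equation is additive to avoid truncated
    subtraction. *)
Lemma trie_distance_depths i j m : i != j -> trie_distance bit i j m ->
  exists l x y, depths_eq i j l x y /\ (m + 2 * l = x + y)%N.
Proof.
move=> ij [t Ht [u [v [p [su sv /andP[pth uq] lst sz]]]]].
have [c [a [s [uE vE hd sz']]]] := tree_path_size pth uq lst.
have leaf k w : subtree t w = Leaf k -> [/\ w = mkseq (bit k) (size w),
    forall k', k' != k -> mkseq (bit k') (size w) != mkseq (bit k) (size w) &
    w != [::] -> exists2 k', k' != k &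
      mkseq (bit k') (size w).-1 == mkseq (bit k) (size w).-1].
  move=> sw; have [F1 F2] := trie_leafE Ht sw.
  have wE : w = mkseq (bit k) (size w).
    have : k \in [:: k] by rewrite inE.
    by rewrite -F1 mem_filter => /andP[/eqP].
  split=> // [k' k'k|w0].
    apply/negP; rewrite -wE => k'w.
    have : k' \in [:: k] by rewrite -F1 mem_filter k'w mem_enum.
    by rewrite inE (negPf k'k).
  have {F2} := F2 w0; set s' := (X in size X) => s'2.
  have /allPn[k' k's' k'k] : ~~ all (pred1 k) s'.
    apply/negP => /all_pred1P s'E.
    have : uniq s' by rewrite filter_uniq ?enum_uniq.
    by rewrite s'E; move: s'2; case: (size s') => [|[|z]] //= _; rewrite inE eqxx.
  exists k' => //; move: k's'; rewrite mem_filter => /andP[/eqP + _].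
  by rewrite /= => ->; rewrite {2}wE /mkseq -map_take take_iota (minn_idPl (leq_pred _)).
have [uk uk' u1] := leaf _ _ su.
have [vk vk' v1] := leaf _ _ sv.
have agree (f : nat -> bool) w w' b : mkseq f b = w ++ w' -> forall k, k < size w -> f k = nth true w k.
  move=> E k kw; have kb : k < b.
    by rewrite -(size_mkseq f b) E size_cat; apply: leq_trans kw (leq_addr _ _).
  by rewrite -(nth_mkseq true f kb) E nth_cat kw.
have fstdiff (f : nat -> bool) w e w' b : mkseq f b = w ++ e :: w' -> f (size w) = e.
  move=> E; have kb : size w < b.
    by rewrite -(size_mkseq f b) E size_cat /= addnS ltnS leq_addr.
  by rewrite -(nth_mkseq true f kb) E nth_cat ltnn subnn.
(* If [a] or [s] were empty, one address would be a prefix of the other, and the shorter one would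
   not isolate its key. *)
have a0 : a != [::].
  apply/negP => /eqP a0; have := vk' i ij; rewrite -vk; apply/negP/negPn.
  have := uk' j; rewrite eq_sym ij -uk => /(_ isT) /negP; case.
  rewrite uE a0 cats0 in uk *; apply/eqP.
  apply: (@eq_from_nth _ true); rewrite size_mkseq // => k kc.
  rewrite nth_mkseq // (agree (bit j) c s (size v)) // -?vk //.
have s0 : s != [::].
  apply/negP => /eqP s0; have := vk' i ij; rewrite -vk => /negP; case.
  rewrite vE s0 cats0; apply/eqP.
  apply: (@eq_from_nth _ true); rewrite size_mkseq // => k kc.
  rewrite nth_mkseq // (agree (bit i) c a (size u)) // -?uk //.
have hd' := hd a0 s0; exists (size c), (size u), (size v).
have lcp_ok : (mkseq (bit i) (size c) == mkseq (bit j) (size c)) &&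
    (bit i (size c) != bit j (size c)).
  apply/andP; split.
    apply/eq_mkseqP => k kc.
    rewrite (agree (bit i) c a (size u)) -?uk //.
    by rewrite (agree (bit j) c s (size v)) -?vk.
  case: (a) uE a0 hd' => // e a' uE _ /=; case: (s) vE s0 => // e' s' vE _ /= ee.
  by rewrite (fstdiff (bit i) c e a' (size u)) -?uk // (fstdiff (bit j) c e' s' (size v)) -?vk.
have u0 : u != [::] by rewrite uE; case: (c) => //; case: (a) a0.
have v0 : v != [::] by rewrite vE; case: (c) => //; case: (s) s0.
have [ku kui kuE] := u1 u0; have [kv kvj kvE] := v1 v0.
split; last by rewrite uE vE !size_cat -sz sz' mul2n -addnn addnACA [size c + size a]addnC [size c + size s]addnC.
apply/and3P; split.
- rewrite /depths_le andbA lcp_ok /=; apply/andP.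
  by split; apply/forallP => k; apply/implyP; [exact: uk'|exact: vk'].
- apply/negP => /and4P[_ _ /forallP /(_ ku)]; by rewrite kui kuE.
- apply/negP => /and4P[_ _ _ /forallP /(_ kv)]; by rewrite kvj kvE.
Qed.

End Joint.

(** * The joint law of the common prefix and of the two depths *)

Section Counting.
Variables (n N : nat).
Local Notation word := {ffun 'I_N -> bool}.

(** Words are extended by [false] so that [depths_le] applies to them; with [l < x, y <= N] the
    default is never read. *)
Definition word_bit (a : word) (l : nat) : bool :=
  if insub l is Some l' then a l' else false.

Lemma word_bitE (a : word) (l : 'I_N) : word_bit a l = a l.
Proof. by rewrite /word_bit valK. Qed.

Definition agree (x : nat) (a : word) : {set word} :=
  [set b | mkseq (word_bit b) x == mkseq (word_bit a) x].

Lemma card_agree x a : x <= N -> #|agree x a| = 2 ^ (N - x).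
Proof.
move=> xN.
have -> : #|agree x a| =
    #|family (fun l : 'I_N => if l < x then pred1 (a l) else predT)|.
  apply: eq_card => b; rewrite inE; apply/eq_mkseqP/familyP => [E l|E l lx].
    by case: ifP => // lx; rewrite inE -!word_bitE E.
  have lN := leq_trans lx xN; have := E (Ordinal lN).
  by rewrite /= lx inE -!word_bitE => /eqP.
rewrite card_family foldrE big_map big_enum /=.
rewrite (eq_bigr (fun l : 'I_N => if l < x then 1 else 2)); last first.
  by move=> l _; case: ifP => _; rewrite ?card1 ?card_bool.
rewrite -(big_mkord xpredT (fun l => if l < x then 1 else 2)).
rewrite (@big_cat_nat _ _ _ x) //= big_nat big1 ?mul1n; last first.
  by move=> l /andP[_ ->].
rewrite big_nat (eq_bigr (fun=> 2)) -?big_nat ?prod_nat_const_nat //.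
by move=> l /andP[xl _]; rewrite ltnNge xl.
Qed.

Lemma agreeW x y a : x <= y -> agree y a \subset agree x a.
Proof. by move=> xy; apply/fintype.subsetP => b; rewrite !inE; exact: eq_mkseqW. Qed.

Definition split_at (l : nat) (a b : word) : bool :=
  (mkseq (word_bit a) l == mkseq (word_bit b) l) && (word_bit a l != word_bit b l).

Lemma split_atE l a b : split_at l a b = (b \in agree l a :\: agree l.+1 a).
Proof.
rewrite !inE /split_at eq_sym; case: eq_mkseqP => E; rewrite ?andbF //= andbT.
congr (~~ _); apply/eqP/eq_mkseqP => [F k|F]; last by rewrite F.
by rewrite ltnS leq_eqVlt => /predU1P[->|/E].
Qed.

Lemma card_split_at l a : l < N -> #|[set b | split_at l a b]| = 2 ^ (N - l.+1).
Proof.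
move=> lN; have -> : [set b | split_at l a b] = agree l a :\: agree l.+1 a.
  by apply/finset.setP => b; rewrite inE split_atE.
rewrite cardsD (finset.setIidPr (agreeW _ (leqnSn l))) !card_agree ?(ltnW lN) //.
by rewrite -(subnSK lN) expnS mul2n -addnn addnK.
Qed.

(** The two cylinders are disjoint because their prefixes already differ at bit [l < x, y]; their
    sizes simply add up. *)
Lemma card_neither l x y a b : split_at l a b -> l < x <= N -> l < y <= N ->
  #|~: (agree x a :|: agree y b)| = 2 ^ N - (2 ^ (N - x) + 2 ^ (N - y)).
Proof.
move=> /andP[_ ab] /andP[lx xN] /andP[ly yN].
have disj : agree x a :&: agree y b = finset.set0.
  apply/finset.setP => c; rewrite !inE; apply/negP => /andP[/eq_mkseqP ca /eq_mkseqP cb].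
  by rewrite -ca // -cb // eqxx in ab.
rewrite -(card_agree a xN) -(card_agree b yN) -cardsUI disj cards0 addn0.
have := cardsC (agree x a :|: agree y b); rewrite card_ffun card_bool card_ord.
lia.
Qed.

Definition matrix_bit (f : {ffun 'I_n -> word}) (k : 'I_n) : nat -> bool :=
  word_bit (f k).

(** Row [i] is free, row [j] is any word splitting from it at bit [l], and every other row avoids
    the two cylinders, in a number of ways that does not depend on the first two rows. *)
Lemma card_depths_le i j l x y : i != j -> l < x <= N -> l < y <= N ->
  #|[set f | depths_le (matrix_bit f) i j l x y]| =
  2 ^ N * 2 ^ (N - l.+1) * (2 ^ N - (2 ^ (N - x) + 2 ^ (N - y))) ^ (n - 2).
Proof.
move=> ij lx ly; have lN : l < N by case/andP: lx; apply: leq_trans.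
pose q := 2 ^ N - (2 ^ (N - x) + 2 ^ (N - y)).
rewrite -sum1_card (partition_big (fun f : {ffun 'I_n -> word} => (f i, f j))
  (fun ab => split_at l ab.1 ab.2)); last first.
  by move=> f; rewrite inE => /and4P[A B _ _]; apply/andP.
rewrite (eq_bigr (fun=> q ^ (n - 2))) => [|[a b] /= abl].
  rewrite sum_nat_const -/q; congr (_ * _).
  rewrite -sum1_card -(pair_big_dep xpredT (fun a b => split_at l a b) (fun _ _ => 1)) /=.
  rewrite (eq_bigr (fun=> 2 ^ (N - l.+1))) => [|a _].
    by rewrite sum_nat_const card_ffun card_bool card_ord.
  by rewrite sum1_card -(card_split_at a lN) cardsE.
pose F (k : 'I_n) := if k == i then [set a] else if k == j then [set b]
  else ~: (agree x a :|: agree y b).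
transitivity #|family F|.
  rewrite sum1_card; apply: eq_card => f; rewrite [LHS]inE inE /=.
  apply/andP/familyP => [[/and4P[_ _ /forallP Hx /forallP Hy] /eqP[fi fj]] k|H].
    rewrite /F; case: (eqVneq k i) => [->|ki]; first by rewrite inE fi.
    case: (eqVneq k j) => [->|kj]; first by rewrite inE fj.
    by rewrite !inE -fi -fj negb_or; move: (Hx k) (Hy k); rewrite ki kj /= => -> ->.
  have fi : f i = a by move: (H i); rewrite /F eqxx inE => /eqP.
  have fj : f j = b by move: (H j); rewrite /F eq_sym (negPf ij) eqxx inE => /eqP.
  split; last by rewrite fi fj.
  case/andP: (abl) => E D; case/andP: (lx) => lx0 _; case/andP: (ly) => ly0 _.
  have D' x' : l < x' -> mkseq (word_bit a) x' != mkseq (word_bit b) x'.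
    by move=> lx'; apply: contra D => /eq_mkseqP ->.
  apply/and4P; rewrite /matrix_bit fi fj; split=> //.
    apply/forallP => k; apply/implyP => ki; case: (eqVneq k j) => [->|kj].
      by rewrite fj eq_sym D'.
    by have := H k; rewrite /F (negPf ki) (negPf kj) !inE negb_or => /andP[].
  apply/forallP => k; apply/implyP => kj; case: (eqVneq k i) => [->|ki].
    by rewrite fi D'.
  by have := H k; rewrite /F (negPf ki) (negPf kj) !inE negb_or => /andP[].
rewrite card_family foldrE big_map big_enum /= (bigD1 i) //= (bigD1 j) 1?eq_sym //=.
rewrite {1 2}/F eqxx eq_sym (negPf ij) eqxx !cards1 !mul1n.
rewrite (eq_bigr (fun=> q)) => [|k /andP[ki kj]].
  rewrite prod_nat_const; congr (_ ^ _).
  rewrite -[in RHS](card_ord n) -cardsT.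
  have -> : [set: 'I_n] = [set i; j] :|: [set k | (k != i) && (k != j)].
    by apply/finset.setP => k; rewrite !inE; case: (k == i); case: (k == j).
  rewrite cardsU cards2 ij (_ : _ :&: _ = finset.set0) ?cards0 ?subn0 ?addKn ?cardsE //.
  by apply/finset.setP => k; rewrite !inE; case: (k == i); case: (k == j).
by rewrite /F (negPf ki) (negPf kj) (card_neither abl).
Qed.

End Counting.

Local Open Scope classical_set_scope.
Local Open Scope ring_scope.

Lemma measure_bigcup_seq (d : measure_display) (T : measurableType d)
    (R : realType) (P : probability T R) (I : choiceType) (s : seq I)
    (F : I -> set T) : uniq s -> (forall i, measurable (F i)) ->
  trivIset [set` s] F ->
  P (\bigcup_(i in [set` s]) F i) = (\sum_(i <- s) P (F i))%E.
Proof.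
move=> us mF tF; rewrite (fsbig_seq _ _ us).
apply: measure_fin_bigcup => //; exact: finite_seq.
Qed.

(** * From bit matrices to probabilities *)

Section Law.
Context (d : measure_display) (T : measurableType d) (R : realType).
Variables (P : probability T R) (n : nat).
Variables (key : 'I_n -> nat -> T -> bool) (pair : T -> 'I_n * 'I_n).
Hypothesis model : unbiased_trie_model P key pair.

Definition bits_upto (N : nat) (w : T) : {ffun 'I_n -> {ffun 'I_N -> bool}} :=
  [ffun k => [ffun l : 'I_N => key k l w]].

Definition cylinder N q f := [set w | pair w = q /\ bits_upto N w = f].

Definition cylinder_side N (q : 'I_n * 'I_n) (f : {ffun 'I_n -> {ffun 'I_N -> bool}})
    (a : option ('I_n * nat)) : set T :=
  if a is Some (k, l) then key k l @^-1` [set word_bit (f k) l] else pair @^-1` [set q].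

Definition cylinder_index N : seq (option ('I_n * nat)) :=
  None :: [seq Some (p.1, nat_of_ord p.2) | p <- enum {: 'I_n * 'I_N}].

Lemma cylinder_index_uniq N : uniq (cylinder_index N).
Proof.
rewrite /= map_inj_uniq ?enum_uniq ?andbT; first by apply/mapP => -[].
by move=> [a b] [a' b'] [-> /val_inj ->].
Qed.

Lemma cylinderE N q (f : {ffun 'I_n -> {ffun 'I_N -> bool}}) : cylinder q f =
  \bigcap_(a in [set a | a \in cylinder_index N]) cylinder_side q f a.
Proof.
apply/seteqP; split=> [w [wq wf] a|w H].
  rewrite /= inE => /predU1P[->//|/mapP[[k l] _ ->]] /=.
  by rewrite word_bitE -wf !ffunE.
split; first by apply: (H None); rewrite /= inE.
apply/ffunP => k; apply/ffunP => l; rewrite !ffunE -word_bitE.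
apply: (H (Some (k, nat_of_ord l))); rewrite /= inE; apply/orP; right.
by apply/mapP; exists (k, l); rewrite ?mem_enum.
Qed.

Lemma measurable_cylinder N q f : measurable (@cylinder N q f).
Proof.
rewrite cylinderE; apply: fin_bigcap_measurable; first exact: finite_seq.
move=> [[k l]|] _; last exact: measurable_pair model q.
by rewrite -[X in measurable X]setTI; apply: (measurable_key model).
Qed.

Lemma prob_cylinder N (i j : 'I_n) f : (i < j)%N ->
  P (@cylinder N (i, j) f) = ('C(n, 2)%:R^-1 * 2^-1 ^+ (n * N))%:E.
Proof.
move=> ij; rewrite cylinderE (independent_trie model) ?cylinder_index_uniq //.
  rewrite big_cons big_map big_enum /= (uniform_pair model ij) EFinM; congr (_ * _)%E.
  rewrite (eq_bigr (fun=> (2^-1)%:E)); last by move=> k _; exact: (fair_bit model).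
  rewrite prodEFin prodr_const; congr (_ ^+ _)%:E.
  by rewrite card_prod !card_ord.
by move=> [[k l]|] _ /=; eexists.
Qed.

Lemma pair_bits_bigcup N q (S : {set {ffun 'I_n -> {ffun 'I_N -> bool}}}) :
  [set w | pair w = q /\ bits_upto N w \in S] =
  \bigcup_(f in [set` enum S]) cylinder q f.
Proof.
apply/seteqP; split=> [w [wq wS]|w [f]] /=.
  by exists (bits_upto N w); rewrite /= ?mem_enum.
by rewrite mem_enum => fS [-> ->].
Qed.

Lemma measurable_pair_bits N q (S : {set {ffun 'I_n -> {ffun 'I_N -> bool}}}) :
  measurable [set w | pair w = q /\ bits_upto N w \in S].
Proof.
rewrite pair_bits_bigcup; apply: fin_bigcup_measurable => [|f _]; first exact: finite_seq.
exact: measurable_cylinder.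
Qed.

Lemma prob_pair_bits N (i j : 'I_n) (S : {set {ffun 'I_n -> {ffun 'I_N -> bool}}}) :
  (i < j)%N -> P [set w | pair w = (i, j) /\ bits_upto N w \in S] =
  (#|S|%:R * ('C(n, 2)%:R^-1 * 2^-1 ^+ (n * N)))%:E.
Proof.
move=> ij; rewrite pair_bits_bigcup measure_bigcup_seq ?enum_uniq //.
- rewrite big_enum /= (eq_bigr (fun=> ('C(n, 2)%:R^-1 * 2^-1 ^+ (n * N))%:E)).
    by rewrite sumEFin sumr_const mulr_natl.
  by move=> f _; exact: prob_cylinder.
- by move=> f; exact: measurable_cylinder.
- by move=> f g _ _ [w [[_ <-] [_ <-]]].
Qed.

(** The guard is part of the event since [pair] is constrained only in law: its other values have
    probability 0 but may occur. *)
Definition depths_le_event (l x y : nat) : set T := [set w | [&&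
  ((pair w).1 < (pair w).2)%N &
  depths_le (fun k m => key k m w) (pair w).1 (pair w).2 l x y]].

Lemma depths_le_bits (i j : 'I_n) l x y N w : (l < x <= N)%N -> (l < y <= N)%N ->
  depths_le (fun k m => key k m w) i j l x y =
  depths_le (matrix_bit (bits_upto N w)) i j l x y.
Proof.
move=> /andP[lx xN] /andP[ly yN].
have E k m : (m < N)%N -> matrix_bit (bits_upto N w) k m = key k m w.
  move=> mN; rewrite /matrix_bit -[m]/(nat_of_ord (Ordinal mN)) word_bitE.
  by rewrite !ffunE.
have E' k m : (m <= N)%N -> mkseq (matrix_bit (bits_upto N w) k) m = mkseq (fun m => key k m w) m.
  move=> mN; apply/eqP/eq_mkseqP => m' m'm; apply: E; exact: leq_trans mN.
have lN := leq_trans lx xN.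
rewrite /depths_le !E' ?(ltnW lN) // !E //.
congr [&& _, _, _ & _]; apply: eq_forallb => k; by rewrite E'.
Qed.

(* The probability of [depths_le_event l x y], see [prob_depths_le]. *)
Definition law_le (l x y : nat) : R := if (l < x)%N && (l < y)%N then
  2^-1 ^+ l.+1 * (1 - 2^-1 ^+ x - 2^-1 ^+ y) ^+ (n - 2) else 0.

Lemma depths_le_eventE l x y : (l < x)%N -> (l < y)%N ->
  depths_le_event l x y = \bigcup_(q in [set` enum [pred q : 'I_n * 'I_n | (q.1 < q.2)%N]])
    [set w | pair w = q /\ bits_upto (maxn x y) w \in
      [set f | depths_le (matrix_bit f) q.1 q.2 l x y]%SET].
Proof.
move=> lx ly; apply/seteqP; split=> [w /andP[ij H]|w [q /=]].
  exists (pair w); rewrite /= ?mem_enum //; split=> //.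
  by rewrite inE -depths_le_bits // ?lx ?ly ?leq_maxl ?leq_maxr.
rewrite mem_enum => qlt [wq]; rewrite inE -depths_le_bits ?lx ?ly ?leq_maxl ?leq_maxr //.
by move=> H; apply/andP; rewrite wq; split=> //; move: qlt; rewrite inE.
Qed.

Lemma depths_le_event0 l x y : ~~ ((l < x)%N && (l < y)%N) -> depths_le_event l x y = set0.
Proof.
move=> lxy; apply/seteqP; split=> // w /andP[ij H].
have /negP := lxy; apply; apply: depths_le_gt H.
by apply: contraTN ij => /eqP ->; rewrite ltnn.
Qed.

Lemma measurable_depths_le_event l x y : measurable (depths_le_event l x y).
Proof.
have [/andP[lx ly]|lxy] := boolP ((l < x)%N && (l < y)%N); last by rewrite depths_le_event0.
rewrite depths_le_eventE //; apply: fin_bigcup_measurable => [|q _]; first exact: finite_seq.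
exact: measurable_pair_bits.
Qed.

(** Summing over the pairs cancels the uniform weight, and the powers of [2 ^ N] in the matrix count
    cancel against the weight [2^-1 ^+ (n * N)] of a matrix, so the truncation length [N]
    disappears. *)
Lemma prob_depths_le l x y : (2 <= n)%N -> P (depths_le_event l x y) = (law_le l x y)%:E.
Proof.
move=> n2; rewrite /law_le.
have [/andP[lx ly]|lxy] := boolP ((l < x)%N && (l < y)%N); last by rewrite depths_le_event0 ?measure0.
rewrite depths_le_eventE // measure_bigcup_seq ?enum_uniq //; first last.
- by move=> q q' _ _ [w [[<- _] [<- _]]].
- by move=> q; exact: measurable_pair_bits.
set N := maxn x y.
have [xN yN] : (x <= N)%N /\ (y <= N)%N by rewrite leq_maxl leq_maxr.
set c : R := 2^-1 ^+ l.+1 * (1 - 2^-1 ^+ x - 2^-1 ^+ y) ^+ (n - 2).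
rewrite big_enum /= (eq_bigr (fun=> ('C(n, 2)%:R^-1 * c)%:E)).
  rewrite sumEFin sumr_const -[X in X%:E]mulr_natl mulrA; congr (_ %:E).
  have -> : #|[pred q : 'I_n * 'I_n | (q.1 < q.2)%N]| = 'C(n, 2).
    rewrite -sum1_card /= -(pair_big_dep xpredT (fun i j : 'I_n => (i < j)%N) (fun _ _ => 1%N)) /=.
    rewrite (exchange_big_dep xpredT) //= -bin2_sum big_mkord; apply: eq_bigr => j _.
    by rewrite -(big_ord_widen n (fun=> 1%N)) ?sum1_card ?card_ord // ltnW.
  by rewrite mulfV ?mul1r // pnatr_eq0 -lt0n bin_gt0.
move=> [i j]; rewrite inE /= => ij; rewrite prob_pair_bits //; congr (_ %:E).
rewrite card_depths_le ?lx ?ly //; last by apply: contraTN ij => /eqP ->; rewrite /= ltnn.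
rewrite [LHS]mulrCA; congr (_ * _).
have half x' : (x' <= N)%N -> 2 ^+ (N - x') = 2 ^+ N * 2^-1 ^+ x' :> R.
  by move=> xN'; rewrite -[in 2 ^+ N](subnK xN') exprD exprVn mulfK // expf_neq0 ?pnatr_eq0.
(* As [x] and [y] are positive, each cylinder holds at most half of the words, so the subtraction in
   the count is not truncated. *)
have le2 x' : (l < x')%N -> (2 ^ (N - x') <= 2 ^ N.-1)%N.
  by move=> lx'; rewrite leq_exp2l // -subn1 leq_sub2l // (leq_trans _ lx').
have lN : (l < N)%N by exact: leq_trans xN.
rewrite !natrM !natrX natrB; last first.
  apply: leq_trans (leq_add (le2 _ lx) (le2 _ ly)) _.
  by rewrite addnn -mul2n -expnS; case: (N) lN.
rewrite natrD !natrX !half //.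
have -> : 2 ^+ N - (2 ^+ N * 2^-1 ^+ x + 2 ^+ N * 2^-1 ^+ y) =
    2 ^+ N * (1 - 2^-1 ^+ x - 2^-1 ^+ y) :> R by ring.
have -> : (n * N = N + N + N * (n - 2))%N.
  by rewrite -[in LHS](subnK n2) mulnDl addnC mul2n -addnn [in RHS]mulnC.
rewrite !exprD !exprM /c.
have AB : 2 ^+ N * 2^-1 ^+ N = 1 :> R by rewrite -exprMn mulfV ?expr1n ?pnatr_eq0.
move: (n - 2)%N (2 ^+ N : R) (2^-1 ^+ N : R) AB => m A B AB.
rewrite exprMn.
transitivity ((A * B) ^+ 2 * (A * B) ^+ m *
   (2^-1 ^+ l.+1 * (1 - 2^-1 ^+ x - 2^-1 ^+ y) ^+ m)); last by rewrite AB !expr1n !mul1r.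
by rewrite !exprMn; ring.
Qed.

Definition depths_eq_event (l x y : nat) : set T := [set w |
  ((pair w).1 < (pair w).2)%N &&
  depths_eq (fun k m => key k m w) (pair w).1 (pair w).2 l x y].

Lemma depths_eq_eventE l x y : depths_eq_event l x y = depths_le_event l x y `\`
  (depths_le_event l x.-1 y `|` depths_le_event l x y.-1).
Proof.
apply/seteqP; split=> [w /andP[ij /and3P[A /negP B /negP C]]|w [/andP[ij A] B]].
  by split; [apply/andP|move=> [/andP[_]|/andP[_]]].
apply/andP; split=> //; apply/and3P; split=> //; apply/negP => C; apply: B.
- by left; apply/andP.
- by right; apply/andP.
Qed.

Lemma depths_le_eventI l x y :
  depths_le_event l x.-1 y `&` depths_le_event l x y.-1 = depths_le_event l x.-1 y.-1.
Proof.
apply/seteqP; split=> [w [/andP[ij A] /andP[_ B]]|w /andP[ij A]].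
  apply/andP; split=> //; have := depths_le_meet A B.
  by rewrite (minn_idPl (leq_pred x)) (minn_idPr (leq_pred y)).
by split; apply/andP; split=> //; apply: depths_le_mono A; rewrite ?leq_pred.
Qed.

(** The mixed second difference of [law_le] in the two depths, that is, the point mass of a joint
    distribution function. When a depth is 0 its terms cancel, so [0.-1 = 0] does no harm. *)
Definition trie_law (p : nat * nat * nat) : R :=
  law_le p.1.1 p.1.2 p.2 - law_le p.1.1 p.1.2.-1 p.2
  - law_le p.1.1 p.1.2 p.2.-1 + law_le p.1.1 p.1.2.-1 p.2.-1.

Lemma measurable_depths_eq_event l x y : measurable (depths_eq_event l x y).
Proof.
rewrite depths_eq_eventE; apply: measurableD; first exact: measurable_depths_le_event.
by apply: measurableU; exact: measurable_depths_le_event.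
Qed.

Lemma prob_depths_eq l x y : (2 <= n)%N ->
  P (depths_eq_event l x y) = (trie_law (l, x, y))%:E.
Proof.
move=> n2; have mA := measurable_depths_le_event; rewrite depths_eq_eventE.
have mU : measurable (depths_le_event l x.-1 y `|` depths_le_event l x y.-1).
  exact: measurableU.
rewrite measureD ?ltey_eq ?fin_num_measure //.
rewrite [X in (_ - P X)%E]setIidr; last first.
  move=> w [|] /andP[ij A]; apply/andP; split=> //;
  by apply: depths_le_mono A; rewrite ?leq_pred.
rewrite measureUfinl ?ltey_eq ?fin_num_measure // depths_le_eventI. rewrite /= !prob_depths_le //.
by rewrite /trie_law /= -!EFinD; congr (_%:E); ring.
Qed.

End Law.

(** All that is kept of the model: disjoint events of explicit probability on which [D] is known
    everywhere. To get this, the depth events are cut by [V], where [D] has the predicted value; the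
    part removed lies in the null set where [D] is not the trie distance. *)
Lemma random_trie_distance_law (d : measure_display) (T : measurableType d)
    (R : realType) (P : probability T R) (n : nat) (D : {RV P >-> R}) :
  (2 <= n)%N -> random_trie_distance n D ->
  exists E : nat * nat * nat -> set T,
  [/\ forall p, measurable (E p), trivIset setT E,
      forall p, P (E p) = (trie_law R n p)%:E &
      forall p w, E p w -> D w = p.1.2%:R + p.2%:R - (2 * p.1.1)%:R].
Proof.
move=> n2 [key [pair [model ae_dist]]].
pose E0 p := depths_eq_event key pair p.1.1 p.1.2 p.2.
pose V (p : nat * nat * nat) : set T := D @^-1` [set p.1.2%:R + p.2%:R - (2 * p.1.1)%:R].
have mE0 p : measurable (E0 p) by exact: (measurable_depths_eq_event model).
have mV p : measurable (V p).
  by rewrite -[V p]setTI; apply: measurable_funP => //; exact: measurable_set1.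
exists (fun p => E0 p `&` V p); split.
- by move=> p; apply: measurableI.
- move=> [[l x] y] [[l' x'] y'] _ _ [w [[/andP[_ A] _] [/andP[_ B] _]]].
  by have [/= -> -> ->] := depths_eq_inj A B.
- move=> [[l x] y]; rewrite -(prob_depths_eq model l x y n2).
  rewrite [RHS](measureDI P (mE0 (l, x, y)) (mV (l, x, y))) /=.
  suff -> : P (E0 (l, x, y) `\` V (l, x, y)) = 0%E by rewrite add0e.
  apply: measure_negligible; first exact: measurableD.
  apply: negligibleS ae_dist => w [/andP[ij A] B] /= [m Dm].
  move=> /trie_distance_depths H; apply: B.
  have [|l' [x' [y' [A' E]]]] := H; first by apply: contraTN ij => /eqP ->; rewrite ltnn.
  have [ll xx yy] := depths_eq_inj A A'; move: E; rewrite -ll -xx -yy => E.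
  by rewrite /V /= Dm -natrD -E natrD addrK.
- by move=> p w [].
Qed.

(** * Uniform tails and comparison of consecutive sizes *)

(* The triples (common prefix, depth, depth) within [k] of their typical values
   [0], [h], [h], where [h] is the integer part of [lg n]. *)
Definition box (h k : nat) : seq (nat * nat * nat) :=
  [seq (lx, y) | lx <- [seq (l, x) | l <- index_iota 0 k, x <- index_iota (h - k) (h + k)],
                 y <- index_iota (h - k) (h + k)].

Lemma mem_box h k l x y : ((l, x, y) \in box h k) =
  [&& (l < k)%N, (h - k <= x < h + k)%N & (h - k <= y < h + k)%N].
Proof.
apply/allpairsP/idP => [[[lx y'] /= [/allpairsP[[l' x'] /= [ml mx ->]] my [-> -> ->]]]|/and3P[ml mx my]].
  by move: ml mx my; rewrite !mem_index_iota leq0n /= => -> -> ->.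
exists ((l, x), y); rewrite mem_index_iota my; split=> //.
by apply/allpairsP; exists (l, x); rewrite !mem_index_iota leq0n ml mx.
Qed.

Lemma box_uniq h k : uniq (box h k).
Proof.
apply: allpairs_uniq; [apply: allpairs_uniq|exact: iota_uniq|].
- exact: iota_uniq.
- exact: iota_uniq.
- by move=> [a b] [a' b'] _ _ [-> ->].
- by move=> [a b] [a' b'] _ _ [-> ->].
Qed.

Lemma sum_box (V : nmodType) h k (F : nat * nat * nat -> V) :
  \sum_(p <- box h k) F p = \sum_(0 <= l < k) \sum_(h - k <= x < h + k)
    \sum_(h - k <= y < h + k) F (l, x, y).
Proof. by rewrite !big_allpairs. Qed.

(** The case [a = 0] is included thanks to [0.-1 = 0]; it occurs because [h - k] is truncated. *)
Lemma telescope_pred (V : zmodType) a b (F : nat -> V) : (a < b)%N ->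
  \sum_(a <= x < b) (F x - F x.-1) = F b.-1 - F a.-1.
Proof. by move=> ab; rewrite (telescope_sumr (fun x => F x.-1)) // ltnW. Qed.

(** * Bernoulli-type inequalities *)

Section Bernoulli.
Variable R : realFieldType.
Implicit Types u q : R.

Lemma bernoulli_ge u m : 0 <= u <= 1 -> 1 - m%:R * u <= (1 - u) ^+ m.
Proof.
move=> /andP[u0 u1]; elim: m => [|m IH]; first by rewrite mul0r subr0 expr0.
have [neg|pos] := leP (1 - m%:R * u) 0.
  apply: (@le_trans _ _ 0); last by rewrite exprn_ge0 // subr_ge0.
  by rewrite -natr1; lra.
rewrite exprSr; have := ler_wpM2r (_ : 0 <= 1 - u) IH.
rewrite subr_ge0 => /(_ u1); apply: le_trans.
rewrite -natr1; have : 0 <= m%:R * u * u by rewrite !mulr_ge0 ?ler0n.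
lra.
Qed.

(** A division-free form of [(1 - u)^m <= 1 / (1 + m u)]. *)
Lemma bernoulli_le u m : 0 <= u <= 1 -> (1 - u) ^+ m * (1 + m%:R * u) <= 1.
Proof.
move=> /andP[u0 u1]; elim: m => [|m IH]; first by rewrite expr0 mul0r addr0 mulr1.
apply: le_trans IH; rewrite exprSr -mulrA ler_wpM2l ?exprn_ge0 ?subr_ge0 //.
rewrite -natr1; have : 0 <= m%:R * u * u by rewrite !mulr_ge0 ?ler0n.
have : 0 <= u * u by rewrite mulr_ge0.
nra.
Qed.

(** The difference is [q^m (1 - q)]; apply [bernoulli_le] at [u = 1 - q], with
    [(m + 1) (1 - q) <= 1 + m (1 - q)]. *)
Lemma pow_consecutive_le q m : 0 <= q <= 1 -> 0 <= q ^+ m - q ^+ m.+1 <= m.+1%:R^-1.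
Proof.
move=> /andP[q0 q1]; have -> : q ^+ m - q ^+ m.+1 = q ^+ m * (1 - q) by rewrite exprSr; ring.
rewrite mulr_ge0 ?exprn_ge0 ?subr_ge0 //= -[leRHS]mul1r ler_pdivlMr ?ltr0n //.
have := @bernoulli_le (1 - q) m; rewrite subKr subr_ge0 q1 lerBlDr lerDl q0 => /(_ isT).
apply: le_trans; rewrite -mulrA ler_wpM2l ?exprn_ge0 // -natr1; lra.
Qed.
End Bernoulli.

(** * Consecutive laws and the mass of a box *)

Section LawBounds.
Variable R : realType.
Local Notation half := (2^-1 : R).

Lemma half_pow_le1 m : 0 <= half ^+ m <= 1.
Proof. by rewrite exprn_ge0 ?invr_ge0 ?ler0n //= exprn_ile1 ?invr_ge0 ?ler0n // invf_le1 ?ler1n ?ltr0n. Qed.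

Lemma half_pow_le m : (0 < m)%N -> 0 <= half ^+ m <= half.
Proof.
case: m => // m _; have /andP[h0 h1] := half_pow_le1 m.
rewrite exprS mulr_ge0 ?invr_ge0 ?ler0n //=.
by rewrite -[leRHS]mulr1 ler_wpM2l ?invr_ge0 ?ler0n.
Qed.

Lemma law_base_itv l x y : (l < x)%N -> (l < y)%N -> 0 <= 1 - half ^+ x - half ^+ y <= 1.
Proof.
move=> lx ly; have /andP[? ?] := half_pow_le (leq_ltn_trans (leq0n l) lx).
have /andP[? ?] := half_pow_le (leq_ltn_trans (leq0n l) ly).
by apply/andP; split; lra.
Qed.

Lemma law_le_succ n l x y : (2 <= n)%N ->
  `|law_le R n.+1 l x y - law_le R n l x y| <= (n.-1)%:R^-1.
Proof.
case: n => [|[|m]] // _; rewrite /law_le.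
case: ifP => [/andP[lx ly]|_]; last by rewrite subrr normr0 invr_ge0 ler0n.
rewrite !subSS !subn0 -mulrBr normrM distrC.
have /andP[c0 c1] := half_pow_le1 l.+1; rewrite (ger0_norm c0).
have /andP[d0 d1] := pow_consecutive_le m (law_base_itv lx ly).
rewrite (ger0_norm d0); apply: le_trans d1.
by rewrite -[leRHS]mul1r ler_wpM2r.
Qed.

Lemma trie_law_succ n p : (2 <= n)%N ->
  `|trie_law R n.+1 p - trie_law R n p| <= 4 * (n.-1)%:R^-1.
Proof.
move=> n2; rewrite /trie_law.
have H x y := law_le_succ p.1.1 x y n2.
have := H p.1.2 p.2; have := H p.1.2.-1 p.2; have := H p.1.2 p.2.-1.
have := H p.1.2.-1 p.2.-1; rewrite !ler_norml.
move=> /andP[? ?] /andP[? ?] /andP[? ?] /andP[? ?]; apply/andP; split; lra.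
Qed.

Lemma sum_half_pow k : \sum_(0 <= l < k) half ^+ l.+1 = 1 - half ^+ k.
Proof.
elim: k => [|k IH]; first by rewrite big_nil expr0 subrr.
by rewrite big_nat_recr //= IH exprS; field.
Qed.

(** A mixed second difference summed over a rectangle leaves the distribution function at the four
    corners. *)
Lemma sum_box_law n h k : (0 < k)%N ->
  \sum_(p <- box h k) trie_law R n p = \sum_(0 <= l < k)
    (law_le R n l (h + k).-1 (h + k).-1 - law_le R n l (h - k).-1 (h + k).-1
     - law_le R n l (h + k).-1 (h - k).-1 + law_le R n l (h - k).-1 (h - k).-1).
Proof.
move=> k0; rewrite sum_box; apply: eq_bigr => l _.
have ab : (h - k < h + k)%N.
  by apply: leq_ltn_trans (leq_subr _ _) _; rewrite -[X in (X < _)%N]addn0 ltn_add2l.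
pose H y x := law_le R n l x y - law_le R n l x y.-1.
rewrite exchange_big /=.
under eq_bigr => y _.
  under eq_bigr => x _.
    have -> : trie_law R n (l, x, y) = H y x - H y x.-1 by rewrite /trie_law /H /=; ring.
    over.
  rewrite telescope_pred //.
  over.
pose K y := law_le R n l (h + k).-1 y - law_le R n l (h - k).-1 y.
under eq_bigr => y _.
  have -> : H y (h + k).-1 - H y (h - k).-1 = K y - K y.-1 by rewrite /H /K; ring.
  over.
by rewrite telescope_pred // /K; ring.
Qed.

Lemma law_le_ge n l A : (l < A)%N -> half ^+ l.+1 * (1 - n%:R * (2 * half ^+ A)) <= law_le R n l A A.
Proof.
move=> lA; rewrite /law_le lA /=; have /andP[c0 c1] := half_pow_le1 l.+1.
rewrite ler_wpM2l //; have /andP[a0 a1] := half_pow_le (leq_ltn_trans (leq0n l) lA).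
have u01 : 0 <= 2 * half ^+ A <= 1 by apply/andP; split; lra.
rewrite (_ : 1 - half ^+ A - half ^+ A = 1 - 2 * half ^+ A); last by ring.
apply: le_trans (bernoulli_ge (n - 2) u01); rewrite lerD2l lerN2 ler_wpM2r //.
by rewrite ler_nat leq_subr.
Qed.

Lemma law_leC n l x y : law_le R n l x y = law_le R n l y x.
Proof. by rewrite /law_le andbC addrAC. Qed.

Lemma law_le_ge0 n l x y : 0 <= law_le R n l x y.
Proof.
rewrite /law_le; case: ifP => // /andP[lx ly]; have /andP[c0 _] := half_pow_le1 l.+1.
by rewrite mulr_ge0 // exprn_ge0 //; have /andP[] := law_base_itv lx ly.
Qed.

(** A leaf of depth at most [B] is unlikely when [n] is large compared with [2^B]: the condition on
    [A] is dropped and [bernoulli_le] applied. Here [e] is any upper bound for [2^B / (n - 2)]. *)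
Lemma law_le_le n l A B e : (l < B)%N -> 1 <= e * (n - 2)%:R * half ^+ B -> 0 <= e ->
  law_le R n l B A <= half ^+ l.+1 * e.
Proof.
move=> lB enB e0; rewrite /law_le lB /=; have /andP[c0 _] := half_pow_le1 l.+1.
case: ifP => [lA|_]; last by rewrite mulr_ge0.
rewrite ler_wpM2l //.
have /andP[b0 b1] := half_pow_le1 B; have /andP[a0 a1] := half_pow_le1 A.
have /andP[q0 _] := law_base_itv lB lA.
apply: (@le_trans _ _ ((1 - half ^+ B) ^+ (n - 2))).
  by rewrite lerXn2r ?nnegrE // ?subr_ge0 // lerBlDr lerDl.
have := @bernoulli_le _ (half ^+ B) (n - 2); rewrite b0 b1 => /(_ isT).
have q1 : 0 <= (1 - half ^+ B) ^+ (n - 2) by rewrite exprn_ge0 ?subr_ge0.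
move: ((1 - half ^+ B) ^+ (n - 2)) q1 => q q1 qm.
have H1 : q * ((n - 2)%:R * half ^+ B) <= 1 by nra.
have H2 : q <= q * (e * (n - 2)%:R * half ^+ B) by rewrite -[leLHS]mulr1 ler_wpM2l.
apply: le_trans H2 _; rewrite -[leRHS]mulr1 -!mulrA mulrCA ler_wpM2l //.
Qed.

(** In units of [2^-k], the mass lost is 8 for leaves that are too deep, 1 for each leaf that is too
    shallow, and 1 for a common prefix of length at least [k]; in total 11. *)
Lemma sum_box_law_ge n h k : (4 <= n)%N -> (2 ^ h <= n <= 2 ^ h.+1)%N ->
  1 - 11 * half ^+ k <= \sum_(p <- box h k) trie_law R n p.
Proof.
move=> n4 /andP[hn nh]; case: (posnP k) => [->|k0].
  by rewrite sum_box big_nil expr0; lra.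
have h0 : (0 < h)%N by case: (h) nh => // n2; have := leq_trans n4 n2.
have K01 := half_pow_le1 k; have /andP[K0 K1] := K01.
rewrite sum_box_law //.
apply: (@le_trans _ _ (\sum_(0 <= l < k) half ^+ l.+1 * (1 - 10 * half ^+ k))).
  by rewrite -mulr_suml sum_half_pow; nra.
rewrite !big_nat; apply: ler_sum => l /andP[_ lk].
have /andP[c0 _] := half_pow_le1 l.+1.
have lA : (l < (h + k).-1)%N.
  by case: (h) h0 => // h' _; rewrite addSn /= ltn_addl.
have h2 m : 2 ^+ m * half ^+ m = 1 by rewrite -exprMn mulfV ?expr1n ?pnatr_eq0.
have T1 : half ^+ l.+1 * (1 - 8 * half ^+ k) <= law_le R n l (h + k).-1 (h + k).-1.
  apply: le_trans (law_le_ge n lA); rewrite ler_wpM2l // lerD2l lerN2.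
  have -> : half ^+ (h + k).-1 = 2 * half ^+ h * half ^+ k.
    by rewrite -mulrA -exprD -[in RHS](prednK (ltn_addr k h0)) exprS mulrA mulfV ?mul1r ?pnatr_eq0.
  have : n%:R * half ^+ h <= 2.
    have : n%:R <= 2 * 2 ^+ h :> R by rewrite -exprS -natrX ler_nat.
    move/(ler_wpM2r (_ : 0 <= half ^+ h)) => /(_ _); rewrite -mulrA h2 mulr1; apply.
    by have /andP[] := half_pow_le1 h.
  by move=> H; have := ler_wpM2r K0 H; nra.
have T2 : law_le R n l (h - k).-1 (h + k).-1 <= half ^+ l.+1 * half ^+ k.
  have [lB|lB] := ltnP l (h - k).-1; last first.
    by rewrite /law_le ltnNge lB /= mulr_ge0.
  apply: law_le_le => //.
  have E : h = ((h - k).-1 + k).+1.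
    have hk : (0 < h - k)%N by case: (h - k)%N lB.
    by rewrite -addSn prednK // subnK // ltnW // -subn_gt0.
  (* By [4 <= n], [n <= 2 (n - 2)]. *)
  have N2 : 2 ^+ h <= 2 * (n - 2)%:R :> R.
    by rewrite -natrX -natrM ler_nat (leq_trans hn) //; move: n4; clear; lia.
  have := ler_wpM2r (_ : 0 <= half ^+ h) N2; rewrite h2.
  have /andP[-> _] := half_pow_le1 h => /(_ isT); rewrite {1}E exprS exprD => H.
  apply: le_trans H _; rewrite le_eqVlt; apply/orP; left; by apply/eqP; field.
rewrite [law_le R n l (h + k).-1 (h - k).-1]law_leC.
have := law_le_ge0 n l (h - k).-1 (h - k).-1; nra.
Qed.

End LawBounds.

Definition distance_of (R : realType) (p : nat * nat * nat) : R :=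
  p.1.2%:R + p.2%:R - (2 * p.1.1)%:R.

(** The two depths deviate by at most [2 k] in all, and the prefix contributes at most [2 (k - 1)];
    the slack in [l <= k - 1] absorbs the freedom of [f] in an interval of length 1. *)
Lemma box_distance (R : realType) h k p (f : R) : p \in box h k ->
  (2 * h)%:R <= f <= (2 * h).+1%:R -> `|distance_of R p - f| < (4 * k)%:R.
Proof.
case: p => [[l x] y]; rewrite mem_box => /and3P[lk /andP[x0 x1] /andP[y0 y1]] /andP[f0 f1].
rewrite /distance_of /= ltr_norml.
have lo z : (h - k <= z)%N -> h%:R <= k%:R + z%:R :> R.
  by rewrite leq_subLR -(ler_nat R) natrD.
have hi z : (z < h + k)%N -> z%:R + 1 <= h%:R + k%:R :> R.
  by rewrite natr1 -natrD ler_nat.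
have {}lk : l%:R + 1 <= k%:R :> R by rewrite natr1 ler_nat.
have := ler0n R l; move: (lo _ x0) (lo _ y0) (hi _ x1) (hi _ y1) f0 f1.
rewrite -natr1 !natrM => *; apply/andP; split; lra.
Qed.

Lemma sum_geometric_le (R : realType) (q : R) k N : 0 <= q < 1 ->
  \sum_(0 <= i < N) q ^+ (k + i) <= q ^+ k * (1 - q)^-1.
Proof.
move=> /andP[q0 q1]; under eq_bigr do rewrite exprD.
rewrite -mulr_sumr ler_wpM2l ?exprn_ge0 //.
rewrite -[leRHS]mul1r ler_pdivlMr ?subr_gt0 //.
suff -> : (\sum_(0 <= i < N) q ^+ i) * (1 - q) = 1 - q ^+ N by rewrite lerBlDr lerDl exprn_ge0.
elim: N => [|N IH]; first by rewrite big_nil mul0r expr0 subrr.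
by rewrite big_nat_recr //= mulrDl IH exprS; ring.
Qed.

(** * Integrals of exponentially dominated functions of the distance *)

Section Approximation.
Context (d : measure_display) (T : measurableType d) (R : realType).
Variables (P : probability T R) (n h : nat) (D : {RV P >-> R}) (f s : R) (phi : R -> R).
Hypotheses (n4 : (4 <= n)%N) (nh : (2 ^ h <= n <= 2 ^ h.+1)%N).
Hypothesis fh : (2 * h)%:R <= f <= (2 * h).+1%:R.
Hypotheses (s0 : 0 <= s) (s_small : expR (4 * s) <= 3 / 2).
Hypothesis mphi : measurable_fun setT phi.
Hypothesis phi_bnd : forall z, 0 <= phi z <= expR (s * `|z|).

Variable E : nat * nat * nat -> set T.
Hypothesis mE : forall p, measurable (E p).
Hypothesis tE : trivIset setT E.
Hypothesis PE : forall p, P (E p) = (trie_law R n p)%:E.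
Hypothesis DE : forall p w, E p w -> D w = distance_of R p.

Let B k := \big[setU/set0]_(p <- box h k) E p.
Let g w := (phi (D w - f))%:E.

Let mB k : measurable (B k).
Proof. by apply: bigsetU_measurable => p _. Qed.

Let BP k w : B k w -> exists2 p, p \in box h k & E p w.
Proof. by rewrite /B -bigcup_seq => -[p]; exists p. Qed.

Let PB k : (P (~` B k) <= (11 * 2^-1 ^+ k)%:E)%E.
Proof.
rewrite probability_setC // /B -bigcup_seq measure_bigcup_seq ?box_uniq //.
  under eq_bigr do rewrite PE.
  rewrite sumEFin -EFinB lee_fin; have := sum_box_law_ge R k n4 nh; lra.
by move=> p q _ _; exact: tE.
Qed.

Let mg : measurable_fun setT g.
Proof.
apply/measurable_EFinP; apply: measurableT_comp => //.
by apply: measurable_funB => //; exact: measurable_funP.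
Qed.

Let g0 w : (0 <= g w)%E.
Proof. by rewrite lee_fin; case/andP: (phi_bnd (D w - f)). Qed.

(** A bound for [phi] at deviations up to [4 (j + 1)]. *)
Let c j : R := expR (4 * s * j.+1%:R).

(* [3 / 4] is [3 / 2], the bound on [e^(4 s)], times the rate [1 / 2] of the
   tails [PB]. *)
Let c_le j : c j * (11 * 2^-1 ^+ j) <= 22 * (3 / 4) ^+ j.
Proof.
have -> : c j = expR (4 * s) ^+ j.+1 by rewrite /c -expRM_natr.
have H : expR (4 * s) ^+ j.+1 <= (3 / 2) ^+ j.+1 by rewrite lerXn2r // nnegrE ?expR_ge0.
have h0 : 0 <= 11 * 2^-1 ^+ j :> R by rewrite mulr_ge0 ?exprn_ge0 ?invr_ge0.
apply: le_trans (ler_wpM2r h0 H) _.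
rewrite exprS (_ : (3 / 4) ^+ j = (3 / 2) ^+ j * 2^-1 ^+ j :> R); last first.
  by rewrite -exprMn; congr (_ ^+ _); field.
set u := _ ^+ j; set v := _ ^+ j.
have u0 : 0 <= u * v by rewrite mulr_ge0 // exprn_ge0.
by nra.
Qed.

(** A layer-cake majorant: each layer is the complement of a larger box, weighted by the bound for
    [phi] at deviations up to [4 (k + i + 1)]. Nothing need be known of [D] off the events [E p]. *)
Let dominant k i w : \bar R := ((c (k + i))%:E * (\1_(~` B (k + i)) w)%:E)%E.

Let dominant_ge0 k i w : (0 <= dominant k i w)%E.
Proof. by rewrite /dominant -EFinM lee_fin mulr_ge0 ?expR_ge0. Qed.

Let measurable_dominant k i A : measurable_fun A (dominant k i).
Proof.
apply: measurable_funTS; apply: measurable_funeM.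
by apply/measurable_EFinP; apply: measurable_indic; exact: measurableC.
Qed.

Let g_dominated k w : (~` B k) w ->
  (g w <= \sum_(0 <= i <oo) dominant k i w)%E.
Proof.
move=> nBw; pose m := Num.truncn (`|D w - f| / 4).
have Xm : `|D w - f| < (4 * m.+1)%:R.
  have := truncnS_gt (`|D w - f| / 4); rewrite -/m natrM; lra.
pose i := (m - k)%N.
have ki : (m <= k + i)%N by rewrite -leq_subLR.
(* [i] is large enough for [g w <= c (k + i)]; on [B (k + i)] with [i > 0] the
   distance to [f] would be less than [4 m]. *)
have nBi : (~` B (k + i)) w.
  have [mk|km] := leqP m k; first by rewrite /i (eqP mk) addn0.
  rewrite /i subnKC ?(ltnW km) // => /BP[p pm Ep].
  have := box_distance pm fh; rewrite -(DE Ep) ltNge => /negP; apply.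
  rewrite natrM -ler_pdivlMl //.
  have : m%:R <= `|D w - f| / 4 by rewrite truncn_le divr_ge0.
  lra.
apply: (@le_trans _ _ (dominant k i w)).
  rewrite /dominant -EFinM indicE mem_set // mulr1 lee_fin.
  case/andP: (phi_bnd (D w - f)) => _ /le_trans; apply.
  rewrite ler_expR [4 * s]mulrC -mulrA ler_wpM2l // -natrM ltW // (lt_le_trans Xm) //.
  by rewrite ler_nat leq_mul2l ltnS.
have := @nneseries_lim_ge R (fun i => dominant k i w) xpredT 0 i.+1.
move=> /(_ (fun j _ _ => dominant_ge0 k j w)); apply: le_trans.
by rewrite big_nat_recr //= leeDr // sume_ge0 // => j _; exact: dominant_ge0.
Qed.

(** On the box [D] is explicit and the integral is a finite sum. The rest is bounded by a geometric
    series of ratio [3 / 4], whence [88 = 22 * 4]. The sign of [e] matters for lower bounds, and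
    [k = 0], where the sum is empty, for upper bounds. *)
Lemma approx_integral k : exists2 e : R, 0 <= e <= 88 * (3 / 4) ^+ k &
  (\int[P]_w (phi (D w - f))%:E =
  (\sum_(p <- box h k) trie_law R n p * phi (distance_of R p - f) + e)%:E)%E.
Proof.
have main : (\int[P]_(w in B k) g w =
    (\sum_(p <- box h k) trie_law R n p * phi (distance_of R p - f))%:E)%E.
  rewrite ge0_integral_bigsetU ?box_uniq //; first last.
  - by apply: measurable_funTS.
  - by move=> p q _ _; exact: tE.
  rewrite -sumEFin; apply: eq_bigr => p _.
  under eq_integral => w /set_mem Ew do rewrite /g (DE Ew).
  by rewrite integral_cst //= PE -EFinM mulrC.
have rest : (\int[P]_(w in ~` B k) g w <= (88 * (3 / 4) ^+ k)%:E)%E.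
  have mBc := measurableC (mB k).
  apply: (@le_trans _ _ (\int[P]_(w in ~` B k)
      (\sum_(0 <= i <oo) dominant k i w))%E).
    apply: ge0_le_integral => //.
    - by apply: measurable_funTS.
    - by apply: (@ge0_emeasurable_sum _ _ _ _ (dominant k) xpredT) => [i w *|i *]; [exact: dominant_ge0|exact: measurable_dominant].
    - by move=> w; exact: g_dominated.
  rewrite integral_nneseries //.
  apply: lime_le.
    by apply: is_cvg_nneseries => i *; apply: integral_ge0 => w *; exact: dominant_ge0.
  apply: nearW => N.
  apply: (@le_trans _ _ (\sum_(0 <= i < N) (22 * (3 / 4) ^+ (k + i))%:E)%E).
    apply: lee_sum => i _; rewrite ge0_integralZl_EFin ?expR_ge0 //; last first.
      by apply/measurable_EFinP; apply: measurable_indic; exact: measurableC.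
    have mBi := measurableC (mB (k + i)).
    rewrite integral_indic //.
    apply: (@le_trans _ _ ((c (k + i))%:E * (11 * 2^-1 ^+ (k + i))%:E)%E).
      rewrite lee_wpmul2l ?lee_fin ?expR_ge0 // (le_trans _ (PB (k + i))) //.
      exact: measureIl.
    by rewrite -EFinM lee_fin c_le.
  rewrite sumEFin lee_fin -mulr_sumr.
  have q0 : 0 <= 3 / 4 :> R by lra.
  have q1 : 3 / 4 < 1 :> R by lra.
  have := @sum_geometric_le R _ k N (introT andP (conj q0 q1)); move: (\sum_(_ <= _ < _) _) => S.
  have -> : (1 - 3 / 4)^-1 = 4 :> R by field.
  lra.
have rest0 : (0 <= \int[P]_(w in ~` B k) g w)%E by apply: integral_ge0.
have fin : (\int[P]_(w in ~` B k) g w)%E \is a fin_num.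
  by rewrite ge0_fin_numE // (le_lt_trans rest) // ltry.
exists (fine (\int[P]_(w in ~` B k) g w)%E).
  by rewrite -!lee_fin fineK // rest rest0.
rewrite EFinD fineK // -main -ge0_integral_setU //.
- by rewrite setUv.
- exact: measurableC.
- by rewrite setUv.
- by rewrite disj_set2E setICr.
Qed.
End Approximation.

(** * Merging of the integrals for consecutive sizes *)

Section TestFunction.
Variables (R : realType) (s : R) (phi : R -> R).

(* Both [z |-> e^(t z)] with [s = |t|] small and the indicators of half-lines,
   with [s = 0], are of this kind. *)
Definition exp_dominated := [/\ 0 <= s, expR (4 * s) <= 3 / 2,
  measurable_fun setT phi & forall z, 0 <= phi z <= expR (s * `|z|)].

Lemma approx_trie_integral (d : measure_display) (T : measurableType d)
    (P : probability T R) n h (D : {RV P >-> R}) (f : R) k :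
  exp_dominated -> (4 <= n)%N -> (2 ^ h <= n <= 2 ^ h.+1)%N ->
  (2 * h)%:R <= f <= (2 * h).+1%:R -> random_trie_distance n D ->
  exists2 e : R, 0 <= e <= 88 * (3 / 4) ^+ k &
  (\int[P]_w (phi (D w - f))%:E =
  (\sum_(p <- box h k) trie_law R n p * phi (distance_of R p - f) + e)%:E)%E.
Proof.
move=> [s0 s1 mphi bphi] n4 nh fh HD.
have [E [mE tE PE DE]] := random_trie_distance_law (leq_trans (isT : (2 <= 4)%N) n4) HD.
exact: (approx_integral n4 nh fh s0 s1 mphi bphi mE tE PE DE).
Qed.

Lemma size_box h k : (size (box h k) <= k * (2 * k) * (2 * k))%N.
Proof.
rewrite !size_allpairs !size_iota subn0.
have H : (h + k - (h - k) <= 2 * k)%N.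
  by rewrite leq_subLR mul2n -addnn addnA leq_add2r addnC -leq_subLR.
by rewrite !leq_mul.
Qed.

(** One box and one centre [f] serve both sizes, even when [n + 1 = 2^(h+1)], because
    [approx_trie_integral] admits the right end. Both errors lie in the same interval
    [[0, 88 (3/4)^k]], so its length is paid once. *)
Lemma consecutive_trie_integrals (d d' : measure_display) (T : measurableType d)
    (T' : measurableType d') (P : probability T R) (P' : probability T' R) n h
    (D : {RV P >-> R}) (D' : {RV P' >-> R}) (f : R) k :
  exp_dominated -> (4 <= n)%N -> (2 ^ h <= n < 2 ^ h.+1)%N ->
  (2 * h)%:R <= f <= (2 * h).+1%:R ->
  random_trie_distance n D -> random_trie_distance n.+1 D' ->
  `|fine (\int[P]_w (phi (D w - f))%:E)%E - fine (\int[P']_w (phi (D' w - f))%:E)%E|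
  <= 88 * (3 / 4) ^+ k +
     (k * (2 * k) * (2 * k))%:R * (4 * n.-1%:R^-1 * expR (s * (4 * k)%:R)).
Proof.
move=> Hphi n4 /andP[hn nh] fh HD HD'; have [s0 _ _ bphi] := Hphi.
have hn1 : (2 ^ h <= n <= 2 ^ h.+1)%N by rewrite hn ltnW.
have hn2 : (2 ^ h <= n.+1 <= 2 ^ h.+1)%N by rewrite nh leqW.
have [e e01 ->] := approx_trie_integral k Hphi n4 hn1 fh HD.
have [e' e'01 ->] := approx_trie_integral k Hphi (leqW n4) hn2 fh HD'.
rewrite /=; set S := \sum_(p <- _) _; set S' := \sum_(p <- _) _.
have SS : `|S - S'| <= (k * (2 * k) * (2 * k))%:R * (4 * n.-1%:R^-1 * expR (s * (4 * k)%:R)).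
  rewrite /S /S' -sumrB; apply: le_trans (ler_norm_sum _ _ _) _.
  set c := 4 * _ * _; have c0 : 0 <= c.
    by rewrite mulr_ge0 ?expR_ge0 // mulr_ge0 // invr_ge0 ler0n.
  apply: (@le_trans _ _ (\sum_(p <- box h k) c)); last first.
    rewrite big_const_seq count_predT iter_addr_0 -[leLHS]mulr_natl ler_wpM2r // ler_nat.
    exact: size_box.
  rewrite [leLHS]big_seq [leRHS]big_seq; apply: ler_sum => p pm.
  rewrite -mulrBl normrM; apply: ler_pM => //.
    by rewrite distrC; apply: trie_law_succ; apply: leq_trans n4.
  have /andP[f0 f1] := bphi (distance_of R p - f); rewrite ger0_norm //.
  apply: le_trans f1 _; rewrite ler_expR ler_wpM2l // ltW //.
  exact: box_distance pm fh.
move: SS e01 e'01; rewrite !ler_norml; set c := _ * (4 * _ * _); set q := _ ^+ k.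
move=> /andP[? ?] /andP[? ?] /andP[? ?]; apply/andP; split; lra.
Qed.

End TestFunction.

(* The size before [floor (2 lg n)] goes from [2 h + 1] to [2 h + 2]. *)
Definition before_jump (h : nat) : nat := (2 ^ h.+1).-1.

Lemma before_jumpS h : (before_jump h).+1 = (2 ^ h.+1)%N.
Proof. by rewrite prednK // expn_gt0. Qed.

Lemma before_jump_ge h : (h < before_jump h)%N || (h == 0)%N.
Proof.
case: h => // h; rewrite orbF -ltnS before_jumpS expnS mul2n -addnn.
have := ltn_expl h.+1 (isT : (1 < 2)%N); move: (2 ^ h.+1)%N => m.
by clear; lia.
Qed.

(** The tails fix [k], after which the other term is a constant over [n - 1]. The common centre
    [2 h + 1] is the right one for [before_jump h] and is off by one for the next size. *)
Lemma trie_integrals_merge (R : realType) (d : nat -> measure_display)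
    (T : forall n : nat, measurableType (d n)) (P : forall n : nat, probability (T n) R)
    (Delta : forall n : nat, {RV (P n) >-> R}) (s : R) (phi : R -> R) :
  (forall n : nat, (2 <= n)%N -> random_trie_distance n (Delta n)) ->
  exp_dominated s phi ->
  (fine (\int[P (before_jump h)]_w (phi (Delta (before_jump h) w - (2 * h).+1%:R))%:E)%E -
   fine (\int[P (before_jump h).+1]_w (phi (Delta (before_jump h).+1 w - (2 * h).+1%:R))%:E)%E)
  @[h --> \oo] --> (0 : R).
Proof.
move=> HD Hphi; apply/cvgr0Pnorm_le => e e0.
have [k k88] : exists k, 88 * (3 / 4) ^+ k <= e / 2.
  have q1 : `|3 / 4 : R| < 1 by rewrite ger0_norm //; lra.
  have e1 : 0 < e / 2 / 88 by rewrite !divr_gt0.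
  have /cvgr0Pnorm_le /(_ _ e1) [k _ /(_ k (leqnn k))] := cvg_expr q1.
  rewrite /= ger0_norm ?exprn_ge0 // => H; exists k.
  by rewrite mulrC -ler_pdivlMr.
pose c : R := (k * (2 * k) * (2 * k))%:R * (4 * expR (s * (4 * k)%:R)).
have c0 : 0 <= c by rewrite mulr_ge0 // mulr_ge0 // expR_ge0.
near=> h.
have h2 : (2 <= h)%N by near: h; exists 2%N.
have h0 : (0 < h)%N by apply: leq_trans h2.
have hn : (h < before_jump h)%N by have := before_jump_ge h; rewrite (gtn_eqF h0) orbF.
have n4 : (4 <= before_jump h)%N.
  rewrite -ltnS before_jumpS; apply: leq_trans (_ : 2 ^ 3 <= _)%N => //.
  by rewrite leq_exp2l.
have hp : (2 ^ h <= before_jump h < 2 ^ h.+1)%N.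
  rewrite -before_jumpS leqnn andbT -ltnS before_jumpS expnS mul2n -addnn.
  by rewrite -[X in (X < _)%N]addn0 ltn_add2l expn_gt0.
pose f : R := (2 * h).+1%:R.
have fh : (2 * h)%:R <= f <= f by rewrite ler_nat leqnSn lexx.
have n2 := leq_trans (isT : (2 <= 4)%N) n4.
apply: le_trans (consecutive_trie_integrals k Hphi n4 hp fh (HD _ n2) (HD _ (leqW n2))) _.
rewrite [leRHS](splitr e); apply: lerD => //.
rewrite -mulrA [_^-1 * _]mulrC !mulrA -[_ * _ * expR _]mulrA -/c.
rewrite ler_pdivrMr; last first.
  by rewrite ltr0n -ltnS prednK // ltnW.
have : 2 * c / e <= h%:R.
  near: h; exact: nbhs_infty_ger.
rewrite ler_pdivrMr // => H.
have : h%:R <= (before_jump h).-1%:R :> R.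
  by rewrite ler_nat -ltnS prednK // ltnW.
move=> /(ler_wpM2r (ltW e0)); lra.
Unshelve. all: by end_near. Qed.

(** * Oscillation *)

Section Floor.
Variable R : realType.

Lemma le_two_lg (x : R) m : 0 < x -> (m%:R <= 2 * lg x) = (2 ^+ m <= x ^+ 2).
Proof.
move=> x0; have l2 : 0 < ln (2 : R) by rewrite ln_gt0 // ltr1n.
rewrite /lg mulrA ler_pdivlMr // mulr_natl mulr_natl -!lnXn //.
by rewrite ler_ln // posrE exprn_gt0.
Qed.

Lemma floor_two_lg (x : R) m : 0 < x -> 2 ^+ m <= x ^+ 2 -> x ^+ 2 < 2 ^+ m.+1 ->
  Num.floor (2 * lg x) = m%:Z.
Proof.
move=> x0 mx xm; apply: floor_def.
rewrite -[(m%:Z + 1)%:~R]/((m%:Z + 1%:Z)%:~R) -PoszD addn1 -!pmulrn.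
by rewrite le_two_lg // mx ltNge le_two_lg // -ltNge.
Qed.

Lemma floor_two_lg_itv n h : (2 ^ h <= n < 2 ^ h.+1)%N ->
  (2 * h)%:R <= ((Num.floor (2 * lg (n%:R : R)))%:~R : R) <= (2 * h).+1%:R.
Proof.
move=> /andP[hn nh]; have n0 : 0 < n%:R :> R.
  by rewrite ltr0n (leq_trans _ hn) // expn_gt0.
have sq : 2 ^+ (2 * h) <= (n%:R : R) ^+ 2.
  by rewrite mulnC exprM lerXn2r ?nnegrE ?exprn_ge0 // -natrX ler_nat.
have sq' : (n%:R : R) ^+ 2 < 2 ^+ (2 * h).+2.
  have -> : (2 * h).+2 = (h.+1 * 2)%N by rewrite mulnC mulSn.
  by rewrite exprM ltrXn2r ?nnegrE ?exprn_ge0 // -natrX ltr_nat.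
have [lt1|ge1] := ltP ((n%:R : R) ^+ 2) (2 ^+ (2 * h).+1).
  by rewrite (floor_two_lg n0 sq lt1) -pmulrn lexx ler_nat leqnSn.
by rewrite (floor_two_lg n0 ge1 sq') -pmulrn lexx ler_nat leqnSn.
Qed.

Lemma floor_two_lg_pow h : Num.floor (2 * lg ((2 ^ h)%:R : R)) = (2 * h)%:Z.
Proof.
have E : ((2 ^ h)%:R : R) ^+ 2 = 2 ^+ (2 * h) by rewrite natrX -exprM mulnC.
apply: floor_two_lg; rewrite ?E // ?ltr0n ?expn_gt0 //.
by rewrite exprS ltr_pMl ?exprn_gt0 // ltr1n.
Qed.

(** With [N = 2^(h+1)] this says [N^2 / 2 <= (N - 1)^2 < N^2], true from [N = 4] on; hence
    [0 < h]. *)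
Lemma floor_two_lg_before_jump h : (0 < h)%N ->
  Num.floor (2 * lg ((before_jump h)%:R : R)) = (2 * h).+1%:Z.
Proof.
case: h => // h _; set N : R := 2 ^+ h.+2.
have NE : (before_jump h.+1)%:R = N - 1 :> R.
  by rewrite /N -natrX -before_jumpS -natr1 addrK.
have N4 : 4 <= N.
  rewrite /N !exprS; have : 1 <= 2 ^+ h :> R by rewrite exprn_ege1 // ler1n.
  lra.
have NN : 2 ^+ (2 * h.+1).+2 = N * N :> R.
  by rewrite /N -exprD addnn -mul2n [(2 * h.+2)%N]mulnS.
have NN' : 2 * 2 ^+ (2 * h.+1).+1 = N * N :> R by rewrite -exprS.
rewrite NE; apply: floor_two_lg; first lra.
- by rewrite expr2; nra.
- by rewrite NN expr2; nra.
Qed.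

End Floor.

(** * Transforms of the centred distance as integrals of test functions *)

Section MGF.
Variable R : realType.

Lemma exp_dominated_expR (t : R) : expR (4 * `|t|) <= 3 / 2 ->
  exp_dominated `|t| (fun z => expR (t * z)).
Proof.
move=> t32; split=> //.
  apply: measurableT_comp => //; exact: mulrl_measurable.
by move=> z; rewrite expR_ge0 ler_expR -normrM ler_norm.
Qed.

Lemma exp_dominated_indic (x : R) : exp_dominated 0 (\1_`]-oo, x] : R -> R).
Proof.
split=> //; first by rewrite mulr0 expR0; lra.
by move=> z; rewrite mul0r expR0 indicE; case: (_ \in _); rewrite ?ler01 ?lexx.
Qed.

Context (d : measure_display) (T : measurableType d) (P : probability T R).
Variables (n : nat) (D : {RV P >-> R}).

Lemma mmt_gen_fun_centered t : mmt_gen_fun P (centered n D) t =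
  (\int[P]_w (expR (t * (D w - (Num.floor (2 * lg (n%:R : R)))%:~R)))%:E)%E.
Proof. by rewrite /mmt_gen_fun unlock; apply: eq_integral => w _; rewrite /= mulrC. Qed.

(** The shift [c] lets the value at [x - 1] with centre [2 h + 2] use the same indicator as the
    value at [x] with centre [2 h + 1]. *)
Lemma cdf_centered x c : cdf (centered n D) (x - c) =
  (\int[P]_w (\1_`]-oo, x] (D w - (Num.floor (2 * lg (n%:R : R)))%:~R + c))%:E)%E.
Proof.
set f := (Num.floor _)%:~R; pose g w := D w - f + c.
have mg : measurable_fun setT g.
  by apply: measurable_funD => //; apply: measurable_funB => //; exact: measurable_funP.
have mS : measurable (g @^-1` `]-oo, x]).
  by rewrite -[X in measurable X]setTI; apply: mg => //; exact: measurable_itv.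
transitivity (P (g @^-1` `]-oo, x])).
  rewrite /cdf /distribution /pushforward /=; congr (P _).
  by apply/seteqP; split=> w; rewrite /g /= !in_itv /= /centered /= -/f lerBrDr.
by rewrite -[X in P X]setIT -integral_indic //.
Qed.

Lemma trie_law_ge0 p : (2 <= n)%N -> random_trie_distance n D -> 0 <= trie_law R n p.
Proof.
move=> n2 /(random_trie_distance_law n2) [E [_ _ PE _]].
by rewrite -lee_fin -PE.
Qed.

(** The lower bound takes [k = 5]: the box has mass at least [1 - 11 / 32 >= 1 / 2], and deviations
    there are below [4 * 5 = 20]. The upper bound takes [k = 0]. *)
Lemma mmt_gen_fun_trie_bounds t : expR (4 * `|t|) <= 3 / 2 -> (4 <= n)%N ->
  random_trie_distance n D ->
  ((expR (- (`|t| * 20)) / 2)%:E <= mmt_gen_fun P (centered n D) t <= 88%:E)%E.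
Proof.
move=> t32 n4 HD; rewrite mmt_gen_fun_centered.
have n2 := leq_trans (isT : (2 <= 4)%N) n4.
have Hphi := exp_dominated_expR t32.
pose h := trunc_log 2 n.
have /andP[hn nh] : (2 ^ h <= n < 2 ^ h.+1)%N.
  by apply: trunc_log_bounds => //; apply: leq_trans n2.
have hn1 : (2 ^ h <= n <= 2 ^ h.+1)%N by rewrite hn ltnW.
have fh := floor_two_lg_itv R (introT andP (conj hn nh)).
apply/andP; split; last first.
  have [e /andP[_ e88] ->] := approx_trie_integral 0 Hphi n4 hn1 fh HD.
  by move: e88; rewrite sum_box big_nil add0r lee_fin expr0 mulr1.
have [e /andP[e0 _] ->] := approx_trie_integral 5 Hphi n4 hn1 fh HD.
rewrite lee_fin; set c := expR _.
have c0 : 0 <= c by exact: expR_ge0.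
apply: (@le_trans _ _ (\sum_(p <- box h 5) trie_law R n p * c)); last first.
  rewrite -[leLHS]addr0; apply: lerD => //.
  rewrite [leLHS]big_seq [leRHS]big_seq; apply: ler_sum => p pm.
  rewrite ler_wpM2l ?trie_law_ge0 // ler_expR.
  set z := _ - _; have zb : `|z| <= 20 by apply/ltW/(box_distance pm fh).
  have := ler_norm (- (t * z)); rewrite normrN normrM => H.
  by have := ler_wpM2l (normr_ge0 t) zb; lra.
rewrite -mulr_suml mulrC ler_wpM2r //.
apply: le_trans (sum_box_law_ge R 5 n4 hn1).
by rewrite !exprS expr0; lra.
Qed.

End MGF.

Lemma cvg_limn_einf_esup (R : realType) (u : (\bar R)^nat) (l : \bar R) :
  limn_einf u = l -> limn_esup u = l -> u @ \oo --> l.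
Proof.
rewrite limn_einf_lim limn_esup_lim => ul lu.
apply: (@squeeze_cvge _ _ _ _ (einfs u) _ (esups u)).
- apply: nearW => n; apply/andP; split.
    by apply: ereal_inf_lbound; exists n => /=.
  by apply: ereal_sup_ubound; exists n => /=.
- by rewrite -ul; exact: is_cvg_einfs.
- by rewrite -lu; exact: is_cvg_esups.
Qed.

Lemma cvg_before_jump : before_jump @ \oo --> \oo.
Proof.
apply/cvgnyPge => m; near=> h.
have [hb|/eqP h0] := orP (before_jump_ge h).
  by apply: leq_trans (ltnW hb); near: h; exists m.
have : (0 < h)%N by near: h; exists 1%N.
by rewrite h0.
Unshelve. all: by end_near. Qed.

Lemma cvg_before_jumpS : (before_jump h).+1 @[h --> \oo] --> \oo.
Proof.
apply/cvgnyPge => m; move/cvgnyPge: cvg_before_jump => /(_ m); apply: filterS.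
by move=> h; exact: leqW.
Qed.

Section Oscillation.
Context (R : realType) (d : nat -> measure_display)
    (T : forall n : nat, measurableType (d n))
    (P : forall n : nat, probability (T n) R)
    (Delta : forall n : nat, {RV (P n) >-> R}).
Hypothesis hDelta : forall n : nat, (2 <= n)%N -> random_trie_distance n (Delta n).

Let u t n := mmt_gen_fun (P n) (centered n (Delta n)) t.

Lemma mmt_gen_fun_jump t : expR (4 * `|t|) <= 3 / 2 ->
  fine (u t (before_jump h)) - expR t * fine (u t (before_jump h).+1) @[h --> \oo] --> (0 : R).
Proof.
move=> t32; have := trie_integrals_merge hDelta (exp_dominated_expR t32).
apply: cvg_trans; apply: near_eq_cvg; near=> h.
have h0 : (0 < h)%N by near: h; exists 1%N.
rewrite /u !mmt_gen_fun_centered; congr (_ - _).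
  by rewrite floor_two_lg_before_jump // -pmulrn.
set b := (before_jump h).+1; rewrite -[expR t]/(fine (expR t)%:E).
have bE : (Num.floor (2 * lg (b%:R : R)))%:~R = (2 * h).+2%:R :> R.
  by rewrite /b before_jumpS floor_two_lg_pow -pmulrn mulnS.
(* [fine] is multiplicative on finite values only; finiteness comes from the uniform upper bound. *)
rewrite bE -fineM //; last first.
  have b4 : (4 <= b)%N by rewrite /b before_jumpS (@leq_exp2l 2 2).
  have b2 : (2 <= b)%N by exact: leq_trans b4.
  have /andP[_] := mmt_gen_fun_trie_bounds t32 b4 (hDelta b2).
  rewrite mmt_gen_fun_centered bE => ub.
  rewrite ge0_fin_numE ?(le_lt_trans ub) ?ltry //.
  by apply: integral_ge0 => w _; rewrite lee_fin expR_ge0.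
rewrite -ge0_integralZl_EFin ?expR_ge0 //; last first.
  apply/measurable_EFinP; apply: measurableT_comp => //.
  apply: measurable_funM => //; apply: measurable_funB => //; exact: measurable_funP.
congr fine; apply: eq_integral => w _; rewrite -EFinM -expRD -natr1.
by congr (expR _)%:E; ring.
Unshelve. all: by end_near. Qed.

Lemma mmt_gen_fun_oscillates t : t != 0 -> expR (4 * `|t|) <= 3 / 2 -> oscillates (u t).
Proof.
move=> t0 t32.
pose c : R := expR (- (`|t| * 20)) / 2.
have c0 : 0 < c by rewrite divr_gt0 ?expR_gt0.
have bnd n : (4 <= n)%N -> (c%:E <= u t n <= 88%:E)%E.
  by move=> n4; apply: mmt_gen_fun_trie_bounds => //; apply: hDelta; apply: leq_trans n4.
have inf_ge : (c%:E <= limn_einf (u t))%E.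
  rewrite limn_einf_lim; apply: lime_ge; first exact: is_cvg_einfs.
  near=> n; apply: le_ereal_inf_tmp => _ [m /= nm <-].
  have /bnd/andP[] : (4 <= m)%N by apply: leq_trans nm; near: n; exists 4%N.
  by [].
have sup_le : (limn_esup (u t) <= 88%:E)%E.
  rewrite limn_esup_lim; apply: lime_le; first exact: is_cvg_esups.
  near=> n; apply: ge_ereal_sup => _ [m /= nm <-].
  have /bnd/andP[] : (4 <= m)%N by apply: leq_trans nm; near: n; exists 4%N.
  by [].
split; first exact: lt_le_trans (ltNyr _) inf_ge.
split; last exact: le_lt_trans sup_le (ltry _).
rewrite lt_neqAle limn_einf_sup andbT; apply/negP => /eqP E.
have [l lE] : exists l : R, limn_einf (u t) = l%:E.
  have : limn_einf (u t) \is a fin_num.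
    rewrite fin_numE; apply/andP; split; apply/negP => /eqP F.
      by move: inf_ge; rewrite F.
    by move: sup_le; rewrite -E F.
  by move=> /fineK <-; eexists.
have lc : c <= l by rewrite -lee_fin -lE.
have ul : u t @ \oo --> l%:E by apply: cvg_limn_einf_esup => //; rewrite -E.
have ful : (fine \o u t) @ \oo --> l by apply: fine_cvg.
have H1 : fine (u t (before_jump h)) @[h --> \oo] --> l.
  exact: (cvg_comp _ _ cvg_before_jump ful).
have H2 : fine (u t (before_jump h).+1) @[h --> \oo] --> l.
  exact: (cvg_comp _ _ cvg_before_jumpS ful).
have H3 : fine (u t (before_jump h)) - expR t * fine (u t (before_jump h).+1)
    @[h --> \oo] --> l - expR t * l.
  by apply: cvgB => //; apply: cvgMr.
have E0 : l - expR t * l = 0 := cvg_unique (@Rhausdorff R) H3 (mmt_gen_fun_jump t32).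
have l0 : l != 0 by rewrite gt_eqF ?(lt_le_trans c0).
have /(mulIf l0) E1 : 1 * l = expR t * l by apply/eqP; rewrite mul1r -subr_eq0 E0.
by move/eqP: t0; apply; apply: expR_inj; rewrite expR0.
Unshelve. all: by end_near. Qed.

Lemma cdf_jump x :
  fine (cdf (centered (before_jump h) (Delta (before_jump h))) x) -
  fine (cdf (centered (before_jump h).+1 (Delta (before_jump h).+1)) (x - 1))
  @[h --> \oo] --> (0 : R).
Proof.
have := trie_integrals_merge hDelta (exp_dominated_indic x).
apply: cvg_trans; apply: near_eq_cvg; near=> h.
have h0 : (0 < h)%N by near: h; exists 1%N.
rewrite -[x in cdf _ x]subr0 !cdf_centered floor_two_lg_before_jump //.
rewrite before_jumpS floor_two_lg_pow -before_jumpS.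
congr (fine _ - fine _); apply: eq_integral => w _; congr (\1__ _)%:E.
  by rewrite -pmulrn addr0.
by rewrite -pmulrn mulnS -natr1; ring.
Unshelve. all: by end_near. Qed.

End Oscillation.

(** * No distribution function is invariant under the unit translation *)

Section Shift.
Context (R : realType) (d : measure_display) (T : measurableType d)
  (Q : probability T R) (Y : {RV Q >-> R}).

Let F x := fine (cdf Y x).

Let cdfE x : cdf Y x = (F x)%:E.
Proof. by rewrite fineK // fin_num_measure. Qed.

Let ndF : {homo F : x y / x <= y}.
Proof. by move=> x y xy; rewrite -lee_fin -!cdfE; exact: cdf_nondecreasing. Qed.

Let F_bounds x : 0 <= F x <= 1.
Proof. by rewrite -!lee_fin -cdfE cdf_ge0 cdf_le1. Qed.

(** [discontinuity] asks that both one-sided limits exist and differ. Here both exist, by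
    monotonicity on the left and right continuity on the right, so its negation is continuity. *)
Lemma cdf_continuousP x : ~ discontinuity F x -> {for x, continuous (cdf Y)}.
Proof.
move=> ndisc.
have cF : F y @[y --> x^'+] --> F x.
  by have := @cdf_right_continuous _ _ _ _ Y x; rewrite cdfE => /fine_cvg.
have lF : cvg (F y @[y --> x^'-]).
  apply: nondecreasing_at_left_is_cvgr.
    by apply: nearW => a y z _ _; exact: ndF.
  by apply: nearW => a; exists 1 => _ [y _ <-]; case/andP: (F_bounds y).
suff : F y @[y --> x] --> F x.
  move=> Fx; rewrite /prop_for /continuous_at cdfE.
  apply/fine_cvgP; split; last exact: Fx.
  by apply: nearW => y; rewrite cdfE.
apply/left_right_continuousP; split=> //.
have -> : F x = lim (F y @[y --> x^'-]); last exact: lF.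
apply: contrapT => /eqP ne; apply: ndisc; split=> //.
  by apply/cvg_ex; exists (F x).
by rewrite (cvg_lim _ cF) // eq_sym.
Qed.

(** Convergence in distribution says nothing at discontinuities, so invariance is assumed only where
    [x] and [x - 1] are both continuity points. A function constant along [x + Z] contradicts the
    limits 0 and 1. *)
Lemma cdf_shift_invariant_absurd :
  ~ (forall x, {for x, continuous (cdf Y)} -> {for x - 1, continuous (cdf Y)} ->
     cdf Y x = cdf Y (x - 1)).
Proof.
move=> shift.
(* Outside countably many classes modulo 1 the distribution function is
   continuous along [x + Z], hence constant there. *)
pose disc := [set x | discontinuity F x].
have cdisc : countable disc.
  have -> : disc = \bigcup_(n in [set: nat])
      [set x | x \in (`](- n%:R), n%:R[) /\ discontinuity F x].
    apply/seteqP; split=> [x Dx|x [n _ []]] //.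
    exists (Num.truncn `|x|).+1 => //; split=> //.
    by rewrite in_itv /= -ltr_norml truncnS_gt.
  apply: bigcup_countable => // n _; apply: discontinuity_countable.
  by move=> x y _ _; exact: ndF.
(* Otherwise countably many translates of a countable set would cover the line, which has positive
   Lebesgue measure. *)
have [x xok] : exists x, forall z : int, ~ discontinuity F (x + z%:~R).
  apply: contrapT => /forallNP bad.
  have : countable [set: R].
    have -> : [set: R] = \bigcup_(z in [set: int]) ((fun y => y - z%:~R) @` disc).
      apply/seteqP; split=> // x _; have /existsNP[z /contrapT Dz] := bad x.
      by exists z => //; exists (x + z%:~R); rewrite // addrK.
    apply: bigcup_countable => // z _; apply: sub_countable cdisc; exact: card_image_le.
  move/countable_lebesgue_measure0 => L0.
  have : (lebesgue_measure (`[0%R, 1%R] : set R) <= lebesgue_measure [set: R])%E.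
    by apply: le_measure; rewrite ?inE //; exact: measurable_itv.
  by rewrite L0 lebesgue_measure_itv /= lte_fin ltr01 oppr0 adde0 lee_fin ler10.
have step (z : int) : F (x + (z + 1)%:~R) = F (x + z%:~R).
  have E : x + (z + 1)%:~R - 1 = x + z%:~R by rewrite intrD addrA addrK.
  have := shift (x + (z + 1)%:~R); rewrite E => H.
  by rewrite /F H //; apply: cdf_continuousP; exact: xok.
have up n : F (x + n%:R) = F x.
  elim: n => [|n IH]; first by rewrite addr0.
  have -> : x + n.+1%:R = x + (n%:Z + 1)%:~R by rewrite intrD -pmulrn natr1.
  by rewrite step -pmulrn.
have down n : F (x - n%:R) = F x.
  elim: n => [|n IH]; first by rewrite subr0.
  have -> : x - n.+1%:R = x + (- n.+1%:Z)%:~R by rewrite mulrNz -pmulrn.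
  rewrite -step -IH; congr (F (x + _)).
  by rewrite intrD mulrNz -pmulrn -natr1; ring.
have F1 : cdf Y x = 1%E.
  have : cdf Y (x + n%:R) @[n --> \oo] --> 1%E.
    apply: (cvg_comp _ _ _ (cvg_cdfy1 Y)); apply/cvgryPge => A; near=> n.
    by rewrite -lerBlDl; near: n; exact: nbhs_infty_ger.
  under eq_fun do rewrite cdfE up -cdfE.
  by move/(cvg_unique (@ereal_hausdorff R) (cvg_cst _)).
have F0 : cdf Y x = 0%E.
  have : cdf Y (x - n%:R) @[n --> \oo] --> 0%E.
    apply: (cvg_comp _ _ _ (cvg_cdfNy0 Y)); apply/cvgrNyPle => A; near=> n.
    by rewrite lerBlDl -lerBlDr; near: n; exact: nbhs_infty_ger.
  under eq_fun do rewrite cdfE down -cdfE.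
  by move/(cvg_unique (@ereal_hausdorff R) (cvg_cst _)).
by move: F1; rewrite F0 => /eqP; rewrite eq_sym onee_eq0.
Unshelve. all: by end_near. Qed.

End Shift.

Theorem theorem2 (R : realType) (d : nat -> measure_display)
    (T : forall n : nat, measurableType (d n))
    (P : forall n : nat, probability (T n) R)
    (Delta : forall n : nat, {RV (P n) >-> R})
    (hDelta : forall n : nat, (2 <= n)%N -> random_trie_distance n (Delta n)) :
  oscillating_mgf P (fun n : nat => centered n (Delta n)) /\
  (forall (d' : measure_display) (T' : measurableType d')
     (Q : probability T' R) (Y : {RV Q >-> R}),
     ~ cvg_in_distribution P (fun n : nat => centered n (Delta n)) Y).
Proof.
split.
  have l0 : 0 < ln (3 / 2 : R) by rewrite ln_gt0 //; lra.
  (* Within this radius [e^(4 |t|) <= 3 / 2], as [exp_dominated] requires. *)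
  exists (ln (3 / 2) / 4); first by rewrite divr_gt0.
  move=> t t0 tr; apply: (mmt_gen_fun_oscillates hDelta) => //.
  by rewrite -[leRHS]lnK ?posrE // ler_expR; lra.
move=> d' T' Q Y cvgY; apply: (@cdf_shift_invariant_absurd _ _ _ _ Y) => x cx cx1.
have fin y : cdf Y y = (fine (cdf Y y))%:E by rewrite fineK // fin_num_measure.
have lim y : {for y, continuous (cdf Y)} ->
    fine (cdf (centered n (Delta n)) y) @[n --> \oo] --> fine (cdf Y y).
  by move=> /cvgY; rewrite {1}fin; exact: fine_cvg.
have lim0 : fine (cdf Y x) - fine (cdf Y (x - 1)) = 0.
  apply: (cvg_unique (@Rhausdorff R) _ (cdf_jump hDelta x)); apply: cvgB.
    exact: (cvg_comp _ _ cvg_before_jump (lim _ cx)).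
  exact: (cvg_comp _ _ cvg_before_jumpS (lim _ cx1)).
by rewrite fin [RHS]fin; congr (_%:E); apply/eqP; rewrite -subr_eq0 lim0.
Qed.
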